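(* There is a one-sided, non-adaptive algorithm which, given $\epsilon>0$ and query access to an unknown Boolean function $f$ on $n$ variables, makes $\tilde{O}(n^{5/6}\epsilon^{-4})$ queries and tests whether $f$ is monotone versus $\epsilon$-far from monotone; that is, it always outputs Yes if $f$ is monotone, and outputs No with probability at least $2/3$ if $f$ is $\epsilon$-far from monotone.
   Context: View $f:\{0,1\}^n\to\{0,1\}$. For $x,y\in\{0,1\}^n$, $x\prec y$ means $x_i\le y_i$ for all $i$ and $x\ne y$; $f$ is monotone if $f(x)\le f(y)$ whenever $x\prec y$. $f$ is $\epsilon$-far from monotone if $\Pr_{\mathbf{x}}[f(\mathbf{x})\ne g(\mathbf{x})]>\epsilon$ (uniform $\mathbf{x}\in\{0,1\}^n$) for every monotone $g$. Non-adaptive means the queries do not depend on answers to previous queries. *)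

(* Defs.v *)
From HB Require Import structures.
From mathcomp Require Import all_boot all_order all_algebra.
From mathcomp Require Import reals exp.

Set Implicit Arguments.
Unset Strict Implicit.
Unset Printing Implicit Defensive.

Import Order.TTheory GRing.Theory Num.Theory.
Local Open Scope ring_scope.

Definition cube (n : nat) : finType := {ffun 'I_n -> bool}.

Definition prec (n : nat) (x y : cube n) : Prop :=
  (forall i : 'I_n, (x i <= y i)%N) /\ x <> y.

Definition monotone (n : nat) (f : cube n -> bool) : Prop :=
  forall x y : cube n, prec x y -> (f x <= f y)%N.

(* Pr[f(x) <> g(x)] for x uniform on the cube *)
Definition dist (R : realType) (n : nat) (f g : cube n -> bool) : R :=
  #|[set x : cube n | f x != g x]|%:R / #|cube n|%:R.

Definition far_from_monotone (R : realType) (n : nat) (eps : R)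
    (f : cube n -> bool) : Prop :=
  forall g : cube n -> bool, monotone g -> eps < dist R f g.

(* A randomized non-adaptive query algorithm on the n-cube.  A seed (the       *)
(* internal randomness) is drawn from a finite probability space; the list of  *)
(* queries is a function of the seed alone, whereas the output (true for Yes,  *)
(* false for No) is a function of the seed and the list of answers.            *)
Record nonadaptive_algorithm (R : realType) (n : nat) := NonadaptiveAlgorithm {
  seed : finType;
  law : seed -> R;
  law_ge0 : forall w, 0 <= law w;
  law_sum1 : \sum_(w : seed) law w = 1;
  queries : seed -> seq (cube n);
  decide : seed -> seq bool -> bool
}.

Section Algorithm.
Variables (R : realType) (n : nat) (A : nonadaptive_algorithm R n).

Definition output (f : cube n -> bool) (w : seed A) : bool :=
  decide w [seq f x | x <- queries w].

Definition always_yes (f : cube n -> bool) : Prop :=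
  forall w : seed A, output f w = true.

Definition prob_no (f : cube n -> bool) : R :=
  \sum_(w : seed A | output f w == false) law w.

Definition query_complexity : nat := \max_(w : seed A) size (queries w).

End Algorithm.

(* q = O~(g), i.e. q <= g * polylog(g), uniformly on the domain D; the shift   *)
(* by 2 keeps the logarithmic factor bounded away from 0 when g <= 1.          *)
Definition soft_bigO (R : realType) (I : Type) (D : I -> Prop) (q g : I -> R)
    : Prop :=
  exists (C : R) (k : nat),
    forall i : I, D i -> q i <= C * g i * ln (2%:R + g i) ^+ k.

(* Main.v *)
Require Import Defs.
From HB Require Import structures.
From mathcomp Require Import all_boot all_order all_algebra.
From mathcomp Require Import reals exp.
From mathcomp Require Import ring lra.

Set Implicit Arguments.
Unset Strict Implicit.
Unset Printing Implicit Defensive.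

Import Order.TTheory GRing.Theory Num.Theory.
Local Open Scope ring_scope.

(* Let [f_S] be [f] sorted along the coordinates of [S].  As a function of    *)
(* [S], for a fixed point [x], the boundary of [f_S(x)] comes from violated   *)
(* edges of [f], and sorting does not increase the total of the square roots  *)
(* of the degrees, whichever endpoint each violated edge is charged to.  The  *)
(* undirected Talagrand inequality, proved in the same robust form by a       *)
(* two-point induction, therefore shows that [f_S] hardly depends on a random *)
(* [S]; in particular [f_S] is close to the function sorted along the         *)
(* complement of [S] as well.  Iterating over random halvings of the set of   *)
(* coordinates bounds the distance to monotonicity by O(log n) times the      *)
(* charge.  Charging to the endpoints of a maximal matching of violated edges *)
(* gives  (edges / 2^n) * (matching / 2^n) >= eps^2 / polylog n.              *)
(*                                                                            *)
(* If there are at least n^(1/6) 2^n violated edges, a random edge is         *)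
(* violated with probability n^(-5/6).  Otherwise there is a matching of      *)
(* density s = eps^2 n^(-1/6) / polylog n.  Set each coordinate to 0          *)
(* (resp. 1) with probability about s / sqrt n: the bias of the total mass    *)
(* is O(s), so either the noise often crosses violated edges, which is        *)
(* detected directly, or it preserves the value of [f] at most matched        *)
(* endpoints.  In the latter case the two ends of the noise form a violated   *)
(* pair with probability about s^2 / sqrt n = eps^4 n^(-5/6) / polylog n.     *)

(** The proof has an isoperimetric half and a noise half. In the first, [tracker] treats the sorted
    function at a fixed point as a function of the selected set of coordinates. [charge_transport]
    says that sorting does not increase the total of the square roots of the charged degrees, and
    [robust_talagrand] turns a small charge into a small variance over the selection. Hence
    ([compl_disagreement], [sort_rest_le]), once [f] is sorted along a random half of the
    coordinates, sorting along the other half changes little. [expect_radix_le] iterates this until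
    no coordinate survives, which joins [f] to a monotone function in [robust_directed_talagrand];
    Cauchy-Schwarz over the vertices of a matching then gives [directed_margulis].

    In the second half, [nonpersistent_le] bounds how often one-sided noise changes [f], by a
    second-moment estimate of the shift of mass plus the violated edges crossed, and [caught_ge]
    turns a matching with persistent endpoints into violated pairs. [pair_test_detects] balances the
    ways of rejecting; [tester] repeats the test, and [up_log_rate] absorbs the logarithms. *)

Section Flip.
Variable n : nat.
Implicit Types (x y S : cube n) (i j : 'I_n) (f g : cube n -> bool).

Definition flip i x : cube n := [ffun k => if k == i then ~~ x k else x k].

Lemma flipE i x k : flip i x k = if k == i then ~~ x k else x k.
Proof. by rewrite ffunE. Qed.

Lemma flip_same i x : flip i x i = ~~ x i.
Proof. by rewrite flipE eqxx. Qed.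

Lemma flip_other i j x : j != i -> flip i x j = x j.
Proof. by rewrite flipE => /negbTE->. Qed.

Lemma flipK i : involutive (flip i).
Proof. by move=> x; apply/ffunP=> k; rewrite !flipE; case: eqP => // _; rewrite negbK. Qed.

Lemma flipC i j x : flip i (flip j x) = flip j (flip i x).
Proof. by apply/ffunP=> k; rewrite !flipE; case: eqP => // _; case: eqP. Qed.

Lemma sum_flip (V : nmodType) i (F : cube n -> V) :
  \sum_x F (flip i x) = \sum_x F x.
Proof.
rewrite [RHS](reindex_inj (h := flip i)) //.
exact: inv_inj (flipK i).
Qed.

Definition sorti i f : cube n -> bool := fun x =>
  if x i then f x || f (flip i x) else f x && f (flip i x).

Definition sortl (s : seq 'I_n) f : cube n -> bool :=
  foldl (fun h i => sorti i h) f s.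

Lemma sortl_rcons s i f : sortl (rcons s i) f = sorti i (sortl s f).
Proof. by rewrite /sortl foldl_rcons. Qed.

Lemma sortl_cat s t f : sortl (s ++ t) f = sortl t (sortl s f).
Proof. by rewrite /sortl foldl_cat. Qed.

Lemma sortl_filter_flip s i S f x : i \notin s ->
  sortl [seq k <- s | flip i S k] f x = sortl [seq k <- s | S k] f x.
Proof.
move=> nis; suff -> : [seq k <- s | flip i S k] = [seq k <- s | S k] by [].
apply: eq_in_filter => k ks; rewrite flip_other //.
by apply: contraNneq nis => <-.
Qed.

End Flip.

(** * Charged edges of partially sorted functions *)

Section Tracker.
Variables (n : nat) (f : cube n -> bool).
Implicit Types (P : seq 'I_n) (x S : cube n) (i j k : 'I_n).

(* [tracker P x S] is the value at [x] once [f] has been sorted along the     *)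
(* coordinates of [P] selected by [S].  Direction [j] at the point [(x, S)]   *)
(* flips [S] once [j] has been processed, and flips [x] before that.          *)
Definition tracker P x S := sortl [seq k <- P | S k] f x.

Definition nbx P j x := if j \in P then x else flip j x.
Definition nbS P j S := if j \in P then flip j S else S.

Definition active P j x S :=
  (tracker P x S != tracker P (nbx P j x) (nbS P j S)) &&
  ((j \in P) || (tracker P x S == ~~ x j)).

(* An active edge of colour [b] is charged to its endpoint of value [b].      *)
Definition charged P (c : 'I_n -> cube n -> cube n -> bool) j x S :=
  active P j x S && (c j x S == tracker P x S).

(** The first clause makes [c] a colour of edges rather than of endpoints; the second makes it blind
    to the selection bits of unprocessed coordinates. *)
Definition coloring P (c : 'I_n -> cube n -> cube n -> bool) :=
  (forall j x S, c j (nbx P j x) (nbS P j S) = c j x S) /\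
  (forall i j x S, i \notin P -> c j x (flip i S) = c j x S).

Lemma tracker_flip P i x S : i \notin P -> tracker P x (flip i S) = tracker P x S.
Proof. exact: sortl_filter_flip. Qed.

Lemma tracker_rcons P i x S : i \notin P ->
  tracker (rcons P i) x S =
  if S i then (if x i then tracker P x S || tracker P (flip i x) S
               else tracker P x S && tracker P (flip i x) S)
  else tracker P x S.
Proof.
by move=> niP; rewrite /tracker filter_rcons; case: (S i) => //; rewrite sortl_rcons.
Qed.

Lemma nbxK P j x : nbx P j (nbx P j x) = x.
Proof. by rewrite /nbx; case: (j \in P) => //; rewrite flipK. Qed.

Lemma nbSK P j S : nbS P j (nbS P j S) = S.
Proof. by rewrite /nbS; case: (j \in P) => //; rewrite flipK. Qed.

Lemma active_nb P j x S : active P j (nbx P j x) (nbS P j S) = active P j x S.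
Proof.
rewrite /active nbxK nbSK eq_sym; case: eqP => //= /eqP.
rewrite {3}/nbx; case: ifP => //= _; rewrite flip_same.
by case: (tracker P x S); case: (tracker P _ _); case: (x j).
Qed.

Lemma active_flip P i j x S : i \notin P -> active P j x (flip i S) = active P j x S.
Proof.
move=> niP; rewrite /active.
have -> : nbS P j (flip i S) = flip i (nbS P j S).
  by rewrite /nbS; case: ifP => // _; rewrite flipC.
by rewrite !tracker_flip.
Qed.

Definition recolor P i (c : 'I_n -> cube n -> cube n -> bool) j x S :=
  if (j == i) || ~~ S i then c j x S else
  let x0 := if x i then flip i x else x in
  let x1 := if x i then x else flip i x in
  if active P j x0 S && active P j x1 S then
    (if x i then c j x0 S && c j x1 S else c j x0 S || c j x1 S)
  else if active P j x0 S then c j x0 S else c j x1 S.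

Lemma nbx_rcons P i j x : j != i -> nbx (rcons P i) j x = nbx P j x.
Proof. by move=> ji; rewrite /nbx mem_rcons inE (negbTE ji). Qed.

Lemma nbS_rcons P i j S : j != i -> nbS (rcons P i) j S = nbS P j S.
Proof. by move=> ji; rewrite /nbS mem_rcons inE (negbTE ji). Qed.

Lemma nbx_same P i j x : j != i -> nbx P j x i = x i.
Proof. by move=> ji; rewrite /nbx; case: ifP => // _; rewrite flip_other // eq_sym. Qed.

Lemma nbS_same P i j S : j != i -> nbS P j S i = S i.
Proof. by move=> ji; rewrite /nbS; case: ifP => // _; rewrite flip_other // eq_sym. Qed.

Lemma nbx_flip P i j x : nbx P j (flip i x) = flip i (nbx P j x).
Proof. by rewrite /nbx; case: ifP => // _; rewrite flipC. Qed.

Lemma recolor_coloring P i c : i \notin P -> coloring P c ->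
  coloring (rcons P i) (recolor P i c).
Proof.
move=> niP [c1 c2]; split=> [j x S | k j x S].
  case: (eqVneq j i) => [-> | ji].
    rewrite /recolor eqxx /= /nbx /nbS mem_rcons inE eqxx /=.
    by rewrite c2.
  rewrite nbx_rcons // nbS_rcons // /recolor (negbTE ji) /= nbS_same // nbx_same //.
  case: (S i) => //=.
  by case: (x i); rewrite -!nbx_flip !active_nb !c1.
rewrite mem_rcons inE negb_or => /andP[ki kP].
rewrite /recolor flip_other 1?eq_sym // !active_flip //.
by rewrite !(c2 k).
Qed.

(** Finite check behind [charged_rcons1]: [a], [b] are the values at the ends of an [i]-edge, [a'],
    [b'] those at their neighbours in another direction [j], [o] tells whether [j] is processed, and
    [xj] is the common [j]-th coordinate. *)
Lemma recolor_pair (a b a' b' cu cv o xj : bool) :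
  let vu := (a != a') && (o || (a == ~~ xj)) in
  let vv := (b != b') && (o || (b == ~~ xj)) in
  let c0 := if vu && vv then cu || cv else if vu then cu else cv in
  let c1 := if vu && vv then cu && cv else if vu then cu else cv in
  let Au := vu && (cu == a) in
  let Av := vv && (cv == b) in
  let Bu := ((a && b) != (a' && b')) && (o || ((a && b) == ~~ xj)) && (c0 == (a && b)) in
  let Bv := ((a || b) != (a' || b')) && (o || ((a || b) == ~~ xj)) && (c1 == (a || b)) in
  if a == b then
    if a then (Bu ==> Au || Av) && (Bv ==> Au && Av)
    else (Bv ==> Au || Av) && (Bu ==> Au && Av)
  else if a then (Bv ==> Au) && (Bu ==> Av) else (Bu ==> Au) && (Bv ==> Av).
Proof. by case: a b a' b' cu cv o xj => [] [] [] [] [] [] [] []. Qed.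

Lemma charged_rcons0 P i c j x S : i \notin P -> coloring P c -> ~~ S i ->
  charged (rcons P i) (recolor P i c) j x S = charged P c j x S.
Proof.
move=> niP [c1 c2] nSi; rewrite /charged /recolor nSi orbT.
rewrite /active tracker_rcons // (negbTE nSi).
case: (eqVneq j i) => [-> | ji].
  rewrite /nbx /nbS mem_rcons inE eqxx /= (negbTE niP) andbT.
  rewrite tracker_rcons // flip_same nSi !tracker_flip //.
  by case: (x i); case: (tracker P x S); case: (tracker P (flip i x) S).
rewrite nbx_rcons // nbS_rcons // tracker_rcons // nbS_same // (negbTE nSi).
by rewrite mem_rcons inE (negbTE ji).
Qed.

(** If the two values differ, sorting keeps or exchanges them and the charged edges follow the
    values. If they agree, the new charged sets lie in the union and the intersection of the old
    ones. *)
Lemma charged_rcons1 P i c j (u : cube n) S : i \notin P -> coloring P c -> S i -> ~~ u i ->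
  let v := flip i u in
  let Au := charged P c j u S in
  let Av := charged P c j v S in
  let Bu := charged (rcons P i) (recolor P i c) j u S in
  let Bv := charged (rcons P i) (recolor P i c) j v S in
  if tracker P u S == tracker P v S then
    if tracker P u S then (Bu ==> Au || Av) && (Bv ==> Au && Av)
    else (Bv ==> Au || Av) && (Bu ==> Au && Av)
  else if tracker P u S then (Bv ==> Au) && (Bu ==> Av)
  else (Bu ==> Au) && (Bv ==> Av).
Proof.
move=> niP [c1 c2] Si nui /=.
have vi : flip i u i by rewrite flip_same.
(* Processing [i] turns direction [i] from a flip of the point into a flip of the selection; it is
   active afterwards exactly when the [i]-edge was violated. *)
case: (eqVneq j i) => [-> | ji].
  rewrite /charged /active /recolor eqxx /= /nbx /nbS mem_rcons inE eqxx /= (negbTE niP) /=.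
  rewrite !tracker_rcons // !flip_same Si /= !tracker_flip // (negbTE nui) /= !flipK.
  have := c1 i u S; rewrite /nbx /nbS (negbTE niP) => ->.
  by case: (tracker P u S); case: (tracker P _ S); case: (c i u S).
have := recolor_pair (tracker P u S) (tracker P (flip i u) S)
  (tracker P (nbx P j u) (nbS P j S)) (tracker P (flip i (nbx P j u)) (nbS P j S))
  (c j u S) (c j (flip i u) S) (j \in P) (u j).
rewrite /charged /recolor (negbTE ji) Si /= vi (negbTE nui) flipK.
rewrite /active nbx_rcons // nbS_rcons // !nbx_rcons // !nbx_flip.
rewrite !tracker_rcons // Si vi (negbTE nui) !nbS_same // Si !flip_same !nbx_same // nui (negbTE nui).
rewrite !flipK mem_rcons inE (negbTE ji) /=.
rewrite !(flip_other _ ji) /=.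
by rewrite ![tracker P (flip i _) S || _]orbC ![tracker P (flip i _) (nbS P j S) || _]orbC.
Qed.

End Tracker.

(** * Sorting does not increase the total charge *)

Section Transport.
Variables (R : realType) (n : nat) (f : cube n -> bool).
Implicit Types (P : seq 'I_n) (x S : cube n) (i j k : 'I_n).

(** Concavity of the square root: for a fixed sum, the more spread pair has the smaller sum of
    roots. *)
Lemma sqrt_sum_le (a b m M : R) : 0 <= m -> m <= a -> a <= M -> m + M = a + b ->
  Num.sqrt M + Num.sqrt m <= Num.sqrt a + Num.sqrt b.
Proof.
move=> m0 ma aM e.
have b0 : 0 <= b by lra.
have a0 : 0 <= a by lra.
have M0 : 0 <= M by lra.
rewrite -ler_sqr ?nnegrE ?addr_ge0 ?sqrtr_ge0 // !sqrrD !sqr_sqrtr //.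
rewrite -!sqrtrM //.
have : Num.sqrt (M * m) <= Num.sqrt (a * b).
  rewrite ler_sqrt; last exact: mulr_ge0.
  have -> : m = a + b - M by lra.
  have : 0 <= (M - a) * (M - b) by apply: mulr_ge0; lra.
  by nra.
by lra.
Qed.

Lemma sqrt_card_UI (T : finType) (A B : {set T}) :
  Num.sqrt (#|A :|: B|%:R : R) + Num.sqrt #|A :&: B|%:R <=
  Num.sqrt #|A|%:R + Num.sqrt #|B|%:R.
Proof.
apply: sqrt_sum_le => //.
- by rewrite ler_nat subset_leq_card // subsetIl.
- by rewrite ler_nat subset_leq_card // subsetUl.
by rewrite -!natrD addnC cardsUI.
Qed.

Definition charge P c x S : R := Num.sqrt #|[set j | charged f P c j x S]|%:R.

Lemma sqrt_card_sub (T : finType) (A B : {set T}) : A \subset B ->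
  Num.sqrt (#|A|%:R : R) <= Num.sqrt #|B|%:R.
Proof. by move=> AB; rewrite ler_sqrt ?ler0n // ler_nat subset_leq_card. Qed.

Lemma charge_pair P i c (u : cube n) S : i \notin P -> coloring P c -> S i -> ~~ u i ->
  charge (rcons P i) (recolor f P i c) u S +
  charge (rcons P i) (recolor f P i c) (flip i u) S <=
  charge P c u S + charge P c (flip i u) S.
Proof.
move=> niP cc Si nui; rewrite /charge.
set Bu := [set j | _]; set Bv := [set j | _].
set Au := [set j | _]; set Av := [set j | _].
have H j := charged_rcons1 f j niP cc Si nui.
case: (boolP (tracker f P u S == tracker f P (flip i u) S)) => e; last first.
  case: (boolP (tracker f P u S)) => t.
    rewrite [leRHS]addrC; apply: lerD; apply: sqrt_card_sub; apply/subsetP=> j;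
    rewrite !inE; move: (H j); rewrite /= (negbTE e) t.
      by case/andP => _ /implyP.
    by case/andP => /implyP.
  apply: lerD; apply: sqrt_card_sub; apply/subsetP=> j;
  rewrite !inE; move: (H j); rewrite /= (negbTE e) (negbTE t).
    by case/andP => /implyP.
  by case/andP => _ /implyP.
apply: le_trans (sqrt_card_UI Au Av).
case: (boolP (tracker f P u S)) => t; [|rewrite [leLHS]addrC];
  apply: lerD; apply: sqrt_card_sub; apply/subsetP=> j; rewrite !inE;
  move: (H j); rewrite /= e ?t ?(negbTE t).
- by case/andP => /implyP.
- by case/andP => _ /implyP.
- by case/andP => /implyP.
- by case/andP => _ /implyP.
Qed.

Lemma charge_rcons P i c S : i \notin P -> coloring P c ->
  \sum_x charge (rcons P i) (recolor f P i c) x S <= \sum_x charge P c x S.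
Proof.
move=> niP cc; case: (boolP (S i)) => Si; last first.
  apply: ler_sum => x _; rewrite /charge le_eqVlt; apply/orP; left; apply/eqP.
  congr (Num.sqrt (_%:R)); apply: eq_card => j; rewrite !inE.
  exact: charged_rcons0.
suff: \sum_x (charge (rcons P i) (recolor f P i c) x S +
        charge (rcons P i) (recolor f P i c) (flip i x) S) <=
      \sum_x (charge P c x S + charge P c (flip i x) S).
  rewrite !big_split /= (sum_flip i (fun x => charge (rcons P i) _ x S)).
  rewrite (sum_flip i (fun x => charge P c x S)).
  by lra.
apply: ler_sum => x _.
case: (boolP (x i)) => xi; last exact: charge_pair.
rewrite ![charge _ _ x S + _]addrC.
by have := @charge_pair P i c (flip i x) S niP cc Si; rewrite flipK flip_same xi; apply.
Qed.

Lemma charge_transport c0 L : uniq L -> coloring [::] c0 ->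
  exists2 c, coloring L c &
    \sum_S \sum_x charge L c x S <= \sum_S \sum_x charge [::] c0 x S.
Proof.
elim/last_ind: L => [|L i IH]; first by move=> _ cc; exists c0.
rewrite rcons_uniq => /andP[niL uL] cc.
have [c c1 c2] := IH uL cc.
exists (recolor f L i c); first exact: recolor_coloring.
apply: le_trans c2; apply: ler_sum => S _; exact: charge_rcons.
Qed.

End Transport.

(** * The robust undirected Talagrand inequality *)

Section Poincare.
Variables (R : realType) (n : nat).
Implicit Types (x y S : cube n) (i j k : 'I_n) (L : seq 'I_n) (F G : cube n -> R).

Lemma minkowski2 (a b c d : R) :
  Num.sqrt ((a + c) ^+ 2 + (b + d) ^+ 2) <=
  Num.sqrt (a ^+ 2 + b ^+ 2) + Num.sqrt (c ^+ 2 + d ^+ 2).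
Proof.
have p1 : 0 <= a ^+ 2 + b ^+ 2 by rewrite addr_ge0 // sqr_ge0.
have p2 : 0 <= c ^+ 2 + d ^+ 2 by rewrite addr_ge0 // sqr_ge0.
rewrite -ler_sqr ?nnegrE ?addr_ge0 ?sqrtr_ge0 //.
rewrite [leRHS]sqrrD !sqr_sqrtr ?addr_ge0 ?sqr_ge0 // -sqrtrM //.
have : a * c + b * d <= Num.sqrt ((a ^+ 2 + b ^+ 2) * (c ^+ 2 + d ^+ 2)).
  have [h|h] := lerP (a * c + b * d) 0; first exact: le_trans h (sqrtr_ge0 _).
  rewrite -ler_sqr ?nnegrE ?sqrtr_ge0 ?(ltW h) // sqr_sqrtr ?mulr_ge0 //.
  have -> : (a ^+ 2 + b ^+ 2) * (c ^+ 2 + d ^+ 2) =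
            (a * c + b * d) ^+ 2 + (a * d - b * c) ^+ 2 by ring.
  by rewrite lerDl sqr_ge0.
by rewrite !sqrrD; lra.
Qed.

Definition avg2 i F x : R := (F x + F (flip i x)) / 2.
Definition avgl L F : cube n -> R := foldr avg2 F L.

Lemma avgl_le L F G : (forall x, F x <= G x) -> forall x, avgl L F x <= avgl L G x.
Proof.
move=> FG; elim: L => //= i L IH x; rewrite /avg2.
by have := IH x; have := IH (flip i x); lra.
Qed.

Lemma avglD L F G x : avgl L (fun y => F y + G y) x = avgl L F x + avgl L G x.
Proof.
by elim: L x => //= i L IH x; rewrite /avg2 !IH; lra.
Qed.

Lemma avglB L F G x : avgl L (fun y => F y - G y) x = avgl L F x - avgl L G x.
Proof.
by elim: L x => //= i L IH x; rewrite /avg2 !IH; lra.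
Qed.

Lemma avgl_cst L (a : R) x : avgl L (fun _ => a) x = a.
Proof. by elim: L x => //= i L IH x; rewrite /avg2 !IH; lra. Qed.

Lemma avgl_flip L i F x : avgl L (fun y => F (flip i y)) x = avgl L F (flip i x).
Proof. by elim: L x => //= j L IH x; rewrite /avg2 !IH flipC. Qed.

Lemma avgl_minkowski L F G x :
  Num.sqrt (avgl L F x ^+ 2 + avgl L G x ^+ 2) <=
  avgl L (fun y => Num.sqrt (F y ^+ 2 + G y ^+ 2)) x.
Proof.
elim: L x => //= i L IH x; rewrite /avg2.
set h := avgl L _; set a := avgl L F; set b := avgl L G.
have := minkowski2 (a x / 2) (b x / 2) (a (flip i x) / 2) (b (flip i x) / 2).
have half (u v : R) : Num.sqrt ((u / 2) ^+ 2 + (v / 2) ^+ 2) = Num.sqrt (u ^+ 2 + v ^+ 2) / 2.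
  rewrite !exprMn -mulrDl sqrtrM ?addr_ge0 ?sqr_ge0 //.
  by rewrite sqrtr_sqr ger0_norm ?invr_ge0 ?ler0n.
rewrite -!mulrDl !half => H; apply: le_trans H _.
by have := IH x; have := IH (flip i x); rewrite -/h -/a -/b; lra.
Qed.

Lemma sqrt_ge_of_sqr (a b : R) : a ^+ 2 <= b -> a <= Num.sqrt b.
Proof.
move=> h; apply: le_trans (ler_norm a) _; rewrite -sqrtr_sqr ler_sqrt //.
by apply: le_trans h; exact: sqr_ge0.
Qed.

(** With [A] the sum of the two variances and [e] the squared gap, Minkowski reduces the claim to
    [A + e / 2 <= sqrt (A ^ 2 + e)], which holds because [A <= 1 / 2] and [e <= 1] give
    [A + e / 4 <= 1]. *)
Lemma two_point (p0 p1 d0 d1 : R) : 0 <= p0 <= 1 -> 0 <= p1 <= 1 ->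
  `|p0 - p1| <= d0 + d1 ->
  (p0 + p1) / 2 * (1 - (p0 + p1) / 2) <=
  (Num.sqrt ((p0 * (1 - p0)) ^+ 2 + d0 ^+ 2) +
   Num.sqrt ((p1 * (1 - p1)) ^+ 2 + d1 ^+ 2)) / 2.
Proof.
move=> /andP[a0 a1] /andP[b0 b1] hd.
have := minkowski2 (p0 * (1 - p0)) d0 (p1 * (1 - p1)) d1.
set s0 := Num.sqrt (_ ^+ 2 + d0 ^+ 2); set s1 := Num.sqrt (_ ^+ 2 + d1 ^+ 2).
move=> hm.
suff: (p0 + p1) * (1 - (p0 + p1) / 2) <= s0 + s1 by lra.
apply: le_trans hm; apply: sqrt_ge_of_sqr.
have hd2 : (p0 - p1) ^+ 2 <= (d0 + d1) ^+ 2.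
  rewrite -real_normK ?num_real // ler_sqr ?nnegrE //.
  by apply: le_trans hd; exact: normr_ge0.
apply: le_trans (_ : _ <= (p0 * (1 - p0) + p1 * (1 - p1)) ^+ 2 + (p0 - p1) ^+ 2) _; last by lra.
set A := p0 * (1 - p0) + p1 * (1 - p1).
set e := (p0 - p1) ^+ 2.
have -> : (p0 + p1) * (1 - (p0 + p1) / 2) = A + e / 2 by rewrite /A /e; field.
have A1 : A <= 1 / 2 by rewrite /A; have := sqr_ge0 (p0 - 1 / 2); have := sqr_ge0 (p1 - 1/2); nra.
have A0 : 0 <= A by rewrite /A addr_ge0 // mulr_ge0 //; lra.
have e0 : 0 <= e by exact: sqr_ge0.
have e1 : e <= 1 by rewrite /e; nra.
have -> : (A + e / 2) ^+ 2 = A ^+ 2 + e * (A + e / 4) by field.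
by rewrite lerD2l ler_piMr //; lra.
Qed.

Definition cut (h : cube n -> bool) (c : 'I_n -> cube n -> bool) j S :=
  (h S != h (flip j S)) && (c j S == h S).

(** Induction on the coordinates averaged over. A cut edge in the new direction is charged to
    exactly one endpoint, so the gap between the two half-averages is at most [d0 + d1] as
    [two_point] requires; Minkowski for averages puts the new direction back under the root. *)
Lemma robust_talagrand_avgl (h : cube n -> bool) c L x :
  (forall j S, c j (flip j S) = c j S) ->
  let p := avgl L (fun S => (h S)%:R) x in
  p * (1 - p) <=
  avgl L (fun S => Num.sqrt (\sum_(j <- L) (cut h c j S)%:R)) x.
Proof.
move=> hc; elim: L x => [|i L IH] x /=.
  by case: (h x); rewrite big_nil sqrtr0 ?(mulr0, mul0r) ?subrr ?mulr0.
pose N (S : cube n) : R := \sum_(j <- L) (cut h c j S)%:R.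
pose d (S : cube n) : R := (cut h c i S)%:R.
have N0 S : 0 <= N S by apply: sumr_ge0.
have step y : Num.sqrt ((avgl L (fun S => Num.sqrt (N S)) y) ^+ 2 + avgl L d y ^+ 2)
   <= avgl L (fun S => Num.sqrt (\sum_(j <- i :: L) (cut h c j S)%:R)) y.
  apply: le_trans (avgl_minkowski _ _ _ _) _.
  apply: avgl_le => S; rewrite big_cons -/(N S) -/(d S) sqr_sqrtr //.
  have -> : d S ^+ 2 = d S by rewrite /d; case: (cut _ _ _ _); rewrite ?expr1n ?expr0n.
  by rewrite addrC.
set p := avgl L (fun S => (h S)%:R).
have p01 y : 0 <= p y <= 1.
  apply/andP; split.
    by rewrite -(avgl_cst L 0 y); apply: avgl_le => S.
  by rewrite -(avgl_cst L 1 y); apply: avgl_le => S; case: (h S).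
have hd : `|p x - p (flip i x)| <= avgl L d x + avgl L d (flip i x).
  rewrite -[p (flip i x)]avgl_flip -[avgl L d (flip i x)]avgl_flip -avglD.
  have dd S : `|(h S)%:R - (h (flip i S))%:R : R| <= d S + d (flip i S).
    rewrite /d /cut flipK hc.
    by case: (h S); case: (h _); case: (c i S); rewrite /= ?subrr ?normr0 ?sub0r ?subr0 ?normrN ?normr1; lra.
  rewrite ler_norml; apply/andP; split.
    rewrite lerNl opprB -avglB; apply: avgl_le => S.
    by have := dd S; rewrite ler_norml => /andP[]; lra.
  rewrite -avglB; apply: avgl_le => S.
  by have := dd S; rewrite ler_norml => /andP[]; lra.
have := two_point (p01 x) (p01 (flip i x)) hd; rewrite /avg2 -/p => H.
apply: le_trans H _; rewrite ler_pM2r ?invr_gt0 //.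
have mono y : Num.sqrt ((p y * (1 - p y)) ^+ 2 + avgl L d y ^+ 2) <=
  Num.sqrt ((avgl L (fun S => Num.sqrt (N S)) y) ^+ 2 + avgl L d y ^+ 2).
  rewrite ler_sqrt ?addr_ge0 ?sqr_ge0 // lerD2r ler_sqr ?nnegrE.
  - exact: IH.
  - by have /andP[? ?] := p01 y; apply: mulr_ge0; lra.
  by rewrite -(avgl_cst L 0 y); apply: avgl_le => S; exact: sqrtr_ge0.
by apply: lerD; apply: le_trans (mono _) (step _).
Qed.

Lemma card_cube : #|cube n| = (2 ^ n)%N.
Proof. by rewrite card_ffun card_bool card_ord. Qed.

Definition mean F : R := (\sum_x F x) / 2 ^+ n.

Lemma mean_cst (a : R) : mean (fun _ => a) = a.
Proof.
rewrite /mean sumr_const card_cube -(mulr_natr a) natrX mulfK //.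
by rewrite expf_neq0 // pnatr_eq0.
Qed.

Lemma avgl_mean L F x : uniq L ->
  avgl L F x = mean (fun y => F [ffun k => if k \in L then y k else x k]).
Proof.
elim: L x => [|i L IH] x /=.
  move=> _; rewrite -[LHS](mean_cst (F x)) /mean; congr (_ / _).
  by apply: eq_bigr => y _; congr F; apply/ffunP=> k; rewrite ffunE.
move=> /andP[niL uL]; rewrite /avg2 !IH // /mean -mulrDl mulrAC; congr (_ / _).
pose Q (y : cube n) := F [ffun k => if k \in i :: L then y k else x k].
have -> : \sum_y Q y = (\sum_y Q y + \sum_y Q (flip i y)) / 2 by rewrite sum_flip; lra.
congr (_ / _); rewrite -!big_split /=; apply: eq_bigr => y _; rewrite /Q.
have [xy|xy] := eqVneq (x i) (y i).
  congr (F _ + F _); apply/ffunP=> k; rewrite !ffunE inE.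
    by case: eqP => //= ->; rewrite (negbTE niL).
  by case: eqP => //= ->; rewrite (negbTE niL) xy.
rewrite addrC; congr (F _ + F _); apply/ffunP=> k; rewrite !ffunE inE.
  case: eqP => //= ->; rewrite (negbTE niL).
  by move: xy; case: (x i); case: (y i).
case: eqP => //= ->; rewrite (negbTE niL).
by move: xy; case: (x i); case: (y i).
Qed.

Lemma robust_talagrand (h : cube n -> bool) c :
  (forall j S, c j (flip j S) = c j S) ->
  let p := mean (fun S => (h S)%:R) in
  p * (1 - p) <= mean (fun S => Num.sqrt #|[set j | cut h c j S]|%:R).
Proof.
move=> hc /=.
have allE F : avgl (enum 'I_n) F [ffun => false] = mean F.
  rewrite avgl_mean ?enum_uniq // /mean; congr (_ / _); apply: eq_bigr => y _.
  by congr F; apply/ffunP => k; rewrite ffunE mem_enum.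
have := robust_talagrand_avgl h (enum 'I_n) [ffun => false] hc.
rewrite /= !allE => /le_trans; apply.
rewrite /mean ler_pM2r ?invr_gt0 ?exprn_gt0 //; apply: ler_sum => S _.
rewrite ler_sqrt ?ler0n // big_enum /= -natr_sum ler_nat.
by rewrite -sum1dep_card [leqRHS]big_mkcond /= big_mkcond /=; apply: leq_sum => j _; case: (cut _ _ _ _).
Qed.

Definition compl S : cube n := [ffun k => ~~ S k].

Lemma complK : involutive compl.
Proof. by move=> S; apply/ffunP=> k; rewrite !ffunE negbK. Qed.

(* [h S] and [h (compl S)] each differ from the majority value of [h] with     *)
(* probability [min (p, 1 - p) <= 2 p (1 - p)].                               *)
Lemma compl_disagreement (h : cube n -> bool) c :
  (forall j S, c j (flip j S) = c j S) ->
  \sum_S (h S != h (compl S))%:R <=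
  4 * \sum_S (Num.sqrt #|[set j | cut h c j S]|%:R : R).
Proof.
move=> hc; have := robust_talagrand h hc; rewrite /=.
set p := mean (fun S => _); rewrite /mean.
set T := \sum_(S : cube n) Num.sqrt _.
have n2 : 0 < (2 : R) ^+ n by rewrite exprn_gt0.
rewrite ler_pdivlMr // => H.
have hp : \sum_S (h S)%:R = p * 2 ^+ n :> R by rewrite /p /mean divfK // gt_eqF.
have hq : \sum_S (~~ h S)%:R = (1 - p) * 2 ^+ n :> R.
  have : mean (fun=> 1) = 1 by exact: mean_cst.
  rewrite /mean => /(congr1 (fun z => z * 2 ^+ n)); rewrite divfK ?gt_eqF // mul1r => h1.
  rewrite mulrBl mul1r -hp -h1 -sumrB; apply: eq_bigr => S _.
  by case: (h S); rewrite ?subrr ?subr0.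
have p0 : 0 <= p by rewrite -(pmulr_lge0 _ n2) -hp sumr_ge0.
have p1 : p <= 1 by rewrite -subr_ge0 -(pmulr_lge0 _ n2) -hq sumr_ge0.
have csum (g : cube n -> R) : \sum_S g (compl S) = \sum_S g S.
  by rewrite [RHS](reindex_inj (inv_inj complK)).
have key (b : bool) : \sum_S (h S != h (compl S))%:R <= 2 * \sum_S (h S != b)%:R :> R.
  rewrite mulr2n mulrDl mul1r -{2}(csum (fun S => (h S != b)%:R)) -big_split /=.
  apply: ler_sum => S _; rewrite -natrD ler_nat.
  by case: (h S); case: (h _); case: b.
have [hp2|hp2] := lerP p (1 / 2).
  apply: le_trans (key false) _.
  have -> : \sum_S (h S != false)%:R = p * 2 ^+ n :> R.
    by rewrite -hp; apply: eq_bigr => S _; case: (h S).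
  apply: le_trans (_ : 4 * (p * (1 - p) * 2 ^+ n) <= _); last by rewrite ler_pM2l.
  have : 0 <= p * 2 ^+ n by rewrite mulr_ge0 // ltW.
  by nra.
apply: le_trans (key true) _.
have -> : \sum_S (h S != true)%:R = (1 - p) * 2 ^+ n :> R.
  by rewrite -hq; apply: eq_bigr => S _; case: (h S).
apply: le_trans (_ : 4 * (p * (1 - p) * 2 ^+ n) <= _); last by rewrite ler_pM2l.
have : 0 <= (1 - p) * 2 ^+ n by rewrite mulr_ge0 ?subr_ge0 // ltW.
by nra.
Qed.

End Poincare.

(** * The robust directed Talagrand inequality *)

Section Sorting.
Variables (R : realType) (n : nat).
Implicit Types (x y S b : cube n) (i j k : 'I_n) (L : seq 'I_n) (f g h : cube n -> bool).

Definition hdist f g : R := \sum_x (f x != g x)%:R.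

Lemma hdist_triangle f g h : hdist f h <= hdist f g + hdist g h.
Proof.
rewrite -big_split /=; apply: ler_sum => x _; rewrite -natrD ler_nat.
by case: (f x); case: (g x); case: (h x).
Qed.

Lemma hdistC f g : hdist f g = hdist g f.
Proof. by apply: eq_bigr => x _; rewrite eq_sym. Qed.

Lemma hdist_sorti i f g : hdist (sorti i f) (sorti i g) <= hdist f g.
Proof.
suff: \sum_x ((sorti i f x != sorti i g x)%:R +
              (sorti i f (flip i x) != sorti i g (flip i x))%:R) <=
      \sum_x ((f x != g x)%:R + (f (flip i x) != g (flip i x))%:R : R).
  rewrite !big_split /= (sum_flip i (fun x => (f x != g x)%:R : R)).
  by rewrite (sum_flip i (fun x => (sorti i f x != sorti i g x)%:R : R)) /hdist; lra.
apply: ler_sum => x _; rewrite -!natrD ler_nat /sorti flipK flip_same.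
by case: (x i); case: (f x); case: (g x); case: (f _); case: (g _).
Qed.

Lemma hdist_sortl L f g : hdist (sortl L f) (sortl L g) <= hdist f g.
Proof.
elim: L f g => //= i L IH f g.
exact: le_trans (IH _ _) (hdist_sorti _ _ _).
Qed.

Definition monotone_in i f := forall x, ~~ x i -> f x ==> f (flip i x).

Lemma sorti_monotone_in i f : monotone_in i (sorti i f).
Proof.
move=> x nxi; rewrite /sorti flip_same flipK (negbTE nxi) /=.
by case: (f x); case: (f _).
Qed.

Lemma sorti_keeps_monotone_in i j f : monotone_in j f -> monotone_in j (sorti i f).
Proof.
case: (eqVneq i j) => [-> _|ij mf x nxj]; first exact: sorti_monotone_in.
rewrite /sorti flip_other //.
have := mf x nxj; have := mf (flip i x); rewrite flip_other 1?eq_sym // => /(_ nxj).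
rewrite flipC.
by case: (x i); case: (f x); case: (f (flip i x)); case: (f (flip j x)); case: (f _).
Qed.

Lemma sortl_monotone_in L j f : j \in L -> monotone_in j (sortl L f).
Proof.
elim/last_ind: L => // L i IH; rewrite mem_rcons inE sortl_rcons.
case/orP => [/eqP <-|/IH]; first exact: sorti_monotone_in.
exact: sorti_keeps_monotone_in.
Qed.

Lemma sorti_id i f : monotone_in i f -> sorti i f =1 f.
Proof.
move=> mf x; rewrite /sorti; case: (boolP (x i)) => xi; last first.
  by have := mf x xi; case: (f x).
have := mf (flip i x); rewrite flip_same xi flipK => /(_ isT).
by case: (f x); case: (f _).
Qed.

Lemma sorti_ext i f g : f =1 g -> sorti i f =1 sorti i g.
Proof. by move=> fg x; rewrite /sorti !fg. Qed.

Lemma sortl_ext L f g : f =1 g -> sortl L f =1 sortl L g.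
Proof. by elim: L f g => //= i L IH f g fg; apply: IH; exact: sorti_ext. Qed.

Lemma sortl_id L f : (forall i, i \in L -> monotone_in i f) -> sortl L f =1 f.
Proof.
elim: L => //= i L IH mf x.
rewrite (sortl_ext L (sorti_id (mf i _))) ?mem_head // IH // => j jL.
by apply: mf; rewrite inE jL orbT.
Qed.

Lemma monotone_in_monotone f : (forall i, monotone_in i f) -> monotone f.
Proof.
move=> mf x y [lexy _].
have hyb : forall m, (m <= n)%N ->
    f x ==> f [ffun k : 'I_n => if (k < m)%N then y k else x k].
  elim=> [_|m IH lemn].
    have -> : [ffun k : 'I_n => if (k < 0)%N then y k else x k] = x.
      by apply/ffunP => k; rewrite ffunE.
    exact: implybb.
  have := IH (ltnW lemn); set z := finfun _; set z' := finfun _.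
  pose i := Ordinal lemn; move=> /implyP fz; apply/implyP => /fz {}fz.
  have [zi|zi] := eqVneq (z' i) (z i).
    suff -> : z' = z by [].
    apply/ffunP => k; have [->//|ki] := eqVneq k i.
    rewrite !ffunE ltnS leq_eqVlt.
    by have /negbTE -> : val k != m by apply: contraNneq ki => e; apply/eqP/val_inj.
  have ez : z' = flip i z.
    apply/ffunP => k; rewrite flipE; have [->|ki] := eqVneq k i.
      by move: zi; case: (z' i); case: (z i).
    rewrite !ffunE ltnS leq_eqVlt.
    by have /negbTE -> : val k != m by apply: contraNneq ki => e; apply/eqP/val_inj.
  have nzi : ~~ z i.
    move: zi; rewrite !ffunE /= ltnn leqnn.
    by have := lexy i; case: (x i); case: (y i).
  by rewrite ez; have := mf i z nzi; rewrite fz.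
have := hyb n (leqnn n).
have -> : [ffun k : 'I_n => if (k < n)%N then y k else x k] = y.
  by apply/ffunP => k; rewrite ffunE ltn_ord.
by case: (f x); case: (f y).
Qed.

Section Shuffle.
Variables (f : cube n -> bool) (c0 : 'I_n -> cube n -> cube n -> bool).
Hypothesis c0P : coloring [::] c0.

Let B : R := \sum_S \sum_x charge R f [::] c0 x S.

(** For each fixed [x], [compl_disagreement] applies to the tracker as a function of [S]: its cut
    edges lie in processed directions, where the orientation condition in [active] is void, so they
    are all counted by [charge]. *)
Lemma tracker_compl_le L : uniq L ->
  \sum_S hdist (tracker f L ^~ S) (tracker f L ^~ (compl S)) <= 4 * B.
Proof.
move=> uL; have [c cL cB] := charge_transport R f uL c0P.
apply: (@le_trans _ _ (4 * \sum_S \sum_x charge R f L c x S)); last by rewrite ler_pM2l.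
rewrite /hdist exchange_big /= [X in _ <= 4 * X]exchange_big /= mulr_sumr.
apply: ler_sum => x _.
have [c1 c2] := cL.
have hc j S : c j x (flip j S) = c j x S.
  have [jL|jL] := boolP (j \in L); last exact: c2.
  by have := c1 j x S; rewrite /nbx /nbS jL.
apply: le_trans (@compl_disagreement R n (tracker f L x) (fun j S => c j x S) hc) _.
rewrite ler_pM2l //; apply: ler_sum => S _; apply: sqrt_card_sub.
apply/subsetP => j; rewrite !inE /cut /charged /active => /andP[ne ->]; rewrite andbT.
have [jL|jL] := boolP (j \in L); first by rewrite /nbx /nbS jL ne.
by move: ne; rewrite tracker_flip ?eqxx.
Qed.

Lemma sort_rest_le L : uniq L ->
  \sum_(S : cube n) hdist (sortl [seq k <- L | S k] f)
    (sortl ([seq k <- L | S k] ++ [seq k <- L | ~~ S k]) f) <= 8 * B.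
Proof.
move=> uL; have := tracker_compl_le uL; set T := \sum_S hdist _ _ => hT.
apply: (@le_trans _ _ (2 * T)); last by lra.
rewrite mulr_sumr; apply: ler_sum => S _.
set g := tracker f L ^~ S; set g' := tracker f L ^~ (compl S).
rewrite sortl_cat -[sortl [seq k <- L | S k] f]/g; set s := [seq k <- L | ~~ S k].
(* Sorting along the complement fixes [g'] and contracts distances, so it moves [g] by at most twice
   the distance from [g] to [g']. *)
have e : sortl s g' =1 g'.
  apply: sortl_id => i iS; rewrite /g' /tracker.
  apply: sortl_monotone_in; move: iS; rewrite /s !mem_filter ffunE.
  by [].
apply: le_trans (hdist_triangle g g' _) _.
rewrite mulr2n mulrDl mul1r lerD2l.
have -> : hdist g' (sortl s g) = hdist (sortl s g') (sortl s g).
  by apply: eq_bigr => x _; rewrite e.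
by rewrite [leRHS]hdistC hdist_sortl.
Qed.

Fixpoint expect (k : nat) (F : seq (cube n) -> R) : R :=
  if k is k'.+1 then mean (fun b => expect k' (fun bs => F (b :: bs))) else F [::].

Lemma mean_le (F G : cube n -> R) : (forall b, F b <= G b) -> mean F <= mean G.
Proof. by move=> h; rewrite /mean ler_pM2r ?invr_gt0 ?exprn_gt0 // ler_sum. Qed.

Lemma meanD (F G : cube n -> R) : mean (fun b => F b + G b) = mean F + mean G.
Proof. by rewrite /mean big_split mulrDl. Qed.

Lemma meanZ (a : R) (F : cube n -> R) : mean (fun b => a * F b) = a * mean F.
Proof. by rewrite /mean -mulr_sumr mulrA. Qed.

Lemma eq_mean (F G : cube n -> R) : F =1 G -> mean F = mean G.
Proof. by move=> h; rewrite /mean (eq_bigr G). Qed.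

Lemma mean_exchange (F : cube n -> cube n -> R) :
  mean (fun b => mean (F b)) = mean (fun b' => mean (F ^~ b')).
Proof. by rewrite /mean -!mulr_suml exchange_big. Qed.

Lemma expect_le (k : nat) (F G : seq (cube n) -> R) :
  (forall bs, F bs <= G bs) -> expect k F <= expect k G.
Proof.
by elim: k F G => [|k IH] F G h //=; apply: mean_le => b; apply: IH.
Qed.

Lemma eq_expect (k : nat) (F G : seq (cube n) -> R) : F =1 G -> expect k F = expect k G.
Proof.
by elim: k F G => [|k IH] F G h //=; apply: eq_mean => b; apply: IH => bs.
Qed.

Lemma expectD (k : nat) F G : expect k (fun bs => F bs + G bs) = expect k F + expect k G.
Proof.
elim: k F G => //= k IH F G; rewrite -meanD; apply: eq_mean => b.
by rewrite -IH.
Qed.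

Lemma expectZ (k : nat) a F : expect k (fun bs => a * F bs) = a * expect k F.
Proof.
elim: k F => //= k IH F; rewrite -meanZ; apply: eq_mean => b.
by rewrite -IH.
Qed.

Lemma expect_cst (k : nat) (a : R) : expect k (fun _ => a) = a.
Proof. by elim: k => //= k IH; rewrite (eq_mean (G := fun _ => a)) ?mean_cst. Qed.

Lemma expect_mean (k : nat) (F : cube n -> seq (cube n) -> R) :
  mean (fun b => expect k (F b)) = expect k (fun bs => mean (F ^~ bs)).
Proof.
elim: k F => //= k IH F; rewrite mean_exchange; apply: eq_mean => b.
exact: (IH (fun b' bs => F b' (b :: bs))).
Qed.

Definition part b L := [seq k <- L | b k] ++ [seq k <- L | ~~ b k].
Definition radix (bs : seq (cube n)) L := foldl (fun s b => part b s) L bs.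
Definition alive (bs : seq (cube n)) L := [seq k <- L | all (fun b : cube n => b k) bs].

Lemma perm_part b L : perm_eq (part b L) L.
Proof. by rewrite /part perm_filterC. Qed.

Lemma perm_radix bs L : perm_eq (radix bs L) L.
Proof.
elim: bs L => //= b bs IH L.
exact: perm_trans (IH _) (perm_part b L).
Qed.

(* Radix sorting by independent random bits: each round compares a uniformly  *)
(* random half of the surviving coordinates with the previous survivors, in   *)
(* an order that does not depend on that half.                                *)
Lemma expect_radix_le (k : nat) L : uniq L ->
  expect k (fun bs => hdist (sortl (alive bs L) f) (sortl (radix bs L) f)) <=
  k%:R * (8 * B / 2 ^+ n).
Proof.
elim: k L => [|k IH] L uL /=.
  rewrite mul0r /alive /radix /= filter_predT.
  by rewrite /hdist big1 // => x _; rewrite eqxx.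
(* [F] is the cost of sorting the unselected survivors of [bs] after the selected ones; [G] is the
   induction hypothesis for the list rearranged by [b]. *)
pose F (b : cube n) bs := hdist (sortl [seq i <- alive bs L | b i] f) (sortl (part b (alive bs L)) f).
pose G (b : cube n) bs := hdist (sortl (alive bs (part b L)) f) (sortl (radix bs (part b L)) f).
have FG b bs : hdist (sortl (alive (b :: bs) L) f) (sortl (radix (b :: bs) L) f) <= F b bs + G b bs.
  rewrite /F /G.
  have -> : alive (b :: bs) L = [seq i <- alive bs L | b i].
    by rewrite /alive -filter_predI; apply: eq_filter.
  have -> : alive bs (part b L) = part b (alive bs L).
    rewrite /alive /part filter_cat -!filter_predI.
    by congr (_ ++ _); apply: eq_filter => i /=; rewrite andbC.
  exact: hdist_triangle.
apply: (@le_trans _ _ (mean (fun b => expect k (F b) + expect k (G b)))).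
  by apply: mean_le => b; rewrite -expectD; apply: expect_le => bs; exact: FG.
rewrite meanD expect_mean -natr1 mulrDl mul1r addrC lerD //.
  rewrite -[leRHS](@mean_cst R n); apply: mean_le => b; apply: IH.
  by rewrite (perm_uniq (perm_part b L)).
rewrite -[leRHS](expect_cst k); apply: expect_le => bs.
rewrite /mean ler_pM2r ?invr_gt0 ?exprn_gt0 //.
apply: sort_rest_le; exact: filter_uniq.
Qed.

Lemma mean_bit i : mean (fun b : cube n => (b i)%:R) = 2^-1 :> R.
Proof.
have : mean (fun b : cube n => (b i)%:R + (flip i b i)%:R) = 1 :> R.
  rewrite -[RHS](@mean_cst R n); apply: eq_mean => b; rewrite flip_same.
  by case: (b i); rewrite ?addr0 ?add0r.
rewrite meanD {2}/mean (sum_flip i (fun b : cube n => (b i)%:R)) -/(mean _); lra.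
Qed.

Lemma expect_alive (k : nat) i :
  expect k (fun bs => (all (fun b : cube n => b i) bs)%:R) = 2^-1 ^+ k.
Proof.
elim: k => //= k IH; rewrite exprS -IH -(mean_bit i) mulrC -meanZ.
apply: eq_mean => b; rewrite mulrC -expectZ; apply: eq_expect => bs /=.
by case: (b i); rewrite ?mul1r ?mul0r.
Qed.

Lemma expect_sum (k : nat) (F : 'I_n -> seq (cube n) -> R) :
  expect k (fun bs => \sum_i F i bs) = \sum_i expect k (F i).
Proof.
elim: k F => //= k IH F; rewrite /mean -mulr_suml exchange_big /=; congr (_ / _).
by apply: eq_bigr => b _; rewrite IH.
Qed.

(** When no coordinate survives the [k] halvings, the radix bound compares [f] itself with a fully
    sorted, hence monotone, function; a union bound over coordinates controls survival. *)
Lemma robust_directed_talagrand (eps : R) (k : nat) : 0 <= eps -> far_from_monotone eps f ->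
  eps * (1 - n%:R / 2 ^+ k) * 2 ^+ n <= k%:R * (8 * B / 2 ^+ n).
Proof.
move=> e0 far; apply: le_trans (expect_radix_le k (enum_uniq 'I_n)).
have n2 : 0 < (2 : R) ^+ n by rewrite exprn_gt0.
(* The number of survivors: [1 - bad bs] is at most 1 always and at most 0 as soon as one coordinate
   survives. *)
pose bad bs := \sum_i (all (fun b : cube n => b i) bs)%:R : R.
have -> : eps * (1 - n%:R / 2 ^+ k) * 2 ^+ n =
   expect k (fun bs => eps * 2 ^+ n * (1 + -1 * bad bs)).
  rewrite expectZ expectD expect_cst expectZ expect_sum.
  under eq_bigr do rewrite expect_alive.
  rewrite sumr_const card_ord -[_ *+ n]mulr_natl exprVn; ring.
apply: expect_le => bs.
have [->|nalive] := eqVneq (alive bs (enum 'I_n)) [::]; last first.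
  apply: (@le_trans _ _ 0); last by apply: sumr_ge0.
  apply: mulr_ge0_le0; first by rewrite mulr_ge0 // ltW.
  rewrite mulN1r subr_le0.
  case E : (alive bs _) nalive => [//|i s] _.
  have : i \in alive bs (enum 'I_n) by rewrite E mem_head.
  rewrite mem_filter => /andP[ai _].
  by rewrite /bad (bigD1 i) //= ai lerDl sumr_ge0.
apply: (@le_trans _ _ (eps * 2 ^+ n)).
  rewrite ler_piMr ?mulr_ge0 ?(ltW n2) // mulN1r gerBl.
  by apply: sumr_ge0.
have mono : monotone (sortl (radix bs (enum 'I_n)) f).
  apply: monotone_in_monotone => i; apply: sortl_monotone_in.
  by rewrite (perm_mem (perm_radix _ _)) mem_enum.
have := far _ mono; rewrite /dist card_cube natrX ltr_pdivlMr // => /ltW /le_trans; apply.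
rewrite /hdist -natr_sum ler_nat -sum1dep_card big_mkcond /=.
by apply: leq_sum => x _; case: (_ != _).
Qed.

End Shuffle.
End Sorting.

(** * Matchings of violated edges *)

Section Margulis.
Variables (R : realType) (n : nat) (f : cube n -> bool).
Implicit Types (x u : cube n) (i j : 'I_n) (p : cube n * 'I_n) (E : {set cube n * 'I_n}).

Lemma cauchy_schwarz (I : finType) (a b : I -> R) :
  (\sum_i a i * b i) ^+ 2 <= (\sum_i a i ^+ 2) * (\sum_i b i ^+ 2).
Proof.
have : 0 <= \sum_i \sum_j (a i * b j - a j * b i) ^+ 2.
  by apply: sumr_ge0 => i _; apply: sumr_ge0 => j _; exact: sqr_ge0.
have -> : \sum_i \sum_j (a i * b j - a j * b i) ^+ 2 =
    2 * ((\sum_i a i ^+ 2) * (\sum_i b i ^+ 2)) - 2 * (\sum_i a i * b i) ^+ 2.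
  have e1 : \sum_i \sum_j (a i ^+ 2 * b j ^+ 2) = (\sum_i a i ^+ 2) * (\sum_i b i ^+ 2).
    by rewrite mulr_suml; apply: eq_bigr => i _; rewrite mulr_sumr.
  have e2 : \sum_i \sum_j (a j ^+ 2 * b i ^+ 2) = (\sum_i a i ^+ 2) * (\sum_i b i ^+ 2).
    by rewrite exchange_big.
  have e3 : \sum_i \sum_j ((a i * b i) * (a j * b j)) = (\sum_i a i * b i) ^+ 2.
    by rewrite expr2 mulr_suml; apply: eq_bigr => i _; rewrite mulr_sumr.
  transitivity (\sum_i \sum_j (a i ^+ 2 * b j ^+ 2) + \sum_i \sum_j (a j ^+ 2 * b i ^+ 2)
    - 2 * \sum_i \sum_j ((a i * b i) * (a j * b j))).
    rewrite mulr_sumr -sumrN -!big_split /=; apply: eq_bigr => i _.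
    rewrite mulr_sumr -sumrN -!big_split /=; apply: eq_bigr => j _.
    by ring.
  by rewrite e1 e2 e3; ring.
by lra.
Qed.

Definition viol j x := (f x != f (flip j x)) && (f x == ~~ x j).

Definition upper p := flip p.2 p.1.

Definition violated_edge p := viol p.2 p.1 && ~~ p.1 p.2.

Lemma violated_edgeE p :
  violated_edge p = [&& f p.1, ~~ f (upper p) & ~~ p.1 p.2].
Proof.
rewrite /violated_edge /viol /upper.
by case: (f p.1); case: (f _); case: (p.1 p.2).
Qed.

(** Edges are given by lower endpoint and direction. A violated edge has value 1 below and 0 above,
    so two of them can meet only in their lower or in their upper endpoints. *)
Definition is_matching E :=
  [forall p in E, violated_edge p] &&
  [forall p in E, forall q in E, (p != q) ==> (p.1 != q.1) && (upper p != upper q)].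

Lemma maximal_matching : exists E,
  [/\ {in E, forall p, violated_edge p}, {in E &, injective fst},
      {in E &, injective upper} &
      forall p, violated_edge p ->
        (p.1 \in fst @: E) || (upper p \in upper @: E)].
Proof.
have m0 : is_matching set0.
  by apply/andP; split; apply/forall_inP => p; rewrite inE.
case: (arg_maxnP (fun E => #|E|) m0) => E mE maxE; exists E.
have /andP[/forall_inP vE /forall_inP iE] := mE.
have inj p q : p \in E -> q \in E -> p != q -> (p.1 != q.1) && (upper p != upper q).
  by move=> pE qE; apply/implyP; move: q qE; apply/forall_inP; exact: iE.
split=> //.
- move=> p q pE qE e; apply/eqP; apply: contraT => /(inj _ _ pE qE).
  by rewrite e eqxx.
- move=> p q pE qE e; apply/eqP; apply: contraT => /(inj _ _ pE qE).
  by rewrite e eqxx andbF.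
move=> p vp; apply: contraT; rewrite negb_or => /andP[n1 n2].
have npE : p \notin E by apply: contraNN n1 => pE; exact: imset_f.
have d1 q : q \in E -> (p.1 != q.1) && (upper p != upper q).
  move=> qE; apply/andP; split.
    by apply: contraNneq n1 => ->; exact: imset_f.
  by apply: contraNneq n2 => ->; exact: imset_f.
suff /maxE : is_matching (p |: E) by rewrite cardsU1 npE add1n /= ltnn.
apply/andP; split.
  by apply/forall_inP => q /setU1P[->//|]; exact: vE.
apply/forall_inP => q /setU1P[->|qE]; apply/forall_inP => r /setU1P[->|rE];
  apply/implyP => //.
- by rewrite eqxx.
- by move=> _; exact: d1.
- by move=> _; rewrite eq_sym [upper q == _]eq_sym; exact: d1.
exact: inj.
Qed.

Definition violations : R := \sum_x \sum_j (viol j x)%:R.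

(* Charging every violated edge to a vertex cover [C] of size at most         *)
(* [2 #|E|] turns the robust Talagrand inequality into a product bound.       *)
Lemma directed_margulis (eps : R) (k : nat) E : (2 * n <= 2 ^ k)%N ->
  0 <= eps -> far_from_monotone eps f ->
  (forall p, violated_edge p -> (p.1 \in fst @: E) || (upper p \in upper @: E)) ->
  (eps * 2 ^+ n) ^+ 2 <= 512 * k%:R ^+ 2 * #|E|%:R * violations.
Proof.
move=> hk e0 far cov.
pose C := (fst @: E) :|: (upper @: E).
have cC : (#|C| <= 2 * #|E|)%N.
  by rewrite mul2n -addnn; apply: leq_trans (leq_card_setU _ _) _; apply: leq_add; exact: leq_imset_card.
(* An edge is charged to its lower endpoint if this lies in [C], and otherwise to its upper
   endpoint, which is then in [C] by the covering hypothesis. *)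
pose c0 j x (S : cube n) := (if x j then flip j x else x) \in C.
have c0P : coloring [::] c0.
  split=> [j x S|//]; rewrite /c0 /nbx /nbS /= flip_same flipK.
  by case: (x j).
have := robust_directed_talagrand c0P k e0 far.
set B := \sum_S _.
pose a x : R := #|[set j | charged f [::] c0 j x [ffun => false]]|%:R.
have eB : B = 2 ^+ n * \sum_x Num.sqrt (a x).
  have -> : B = \sum_(S : cube n) \sum_x Num.sqrt (a x) by [].
  by rewrite sumr_const card_cube -natrX mulr_natl.
have n2 : 0 < (2 : R) ^+ n by rewrite exprn_gt0.
have aC x : x \notin C -> a x = 0.
  move=> nxC; rewrite /a; apply/eqP; rewrite pnatr_eq0 cards_eq0; apply/eqP/setP => j.
  rewrite !inE; apply: contraNF nxC.
  rewrite /charged /active /tracker /nbx /nbS /c0 /= => /andP[].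
  case: (boolP (f x)) => fx.
    by case: (x j); rewrite ?andbF //= => _ /eqP.
  case: (boolP (x j)) => xj; rewrite ?andbF //= andbT; case: (boolP (f _)) => // fu _ /eqP.
  move=> /negP nu; have := cov (flip j x, j).
  rewrite violated_edgeE /upper /= flipK flip_same fu fx xj => /(_ isT).
  rewrite /C !inE => /orP[h|->]; last by rewrite orbT.
  by case: nu; rewrite /C inE h.
have hcs : (\sum_x Num.sqrt (a x)) ^+ 2 <= 2 * #|E|%:R * violations.
  have -> : \sum_x Num.sqrt (a x) = \sum_x (x \in C)%:R * Num.sqrt (a x).
    apply: eq_bigr => x _; case: (boolP (x \in C)) => xC; rewrite ?mul1r //.
    by rewrite aC // sqrtr0 mulr0.
  apply: le_trans (cauchy_schwarz _ _) _; apply: ler_pM.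
  - by apply: sumr_ge0 => x _; exact: sqr_ge0.
  - by apply: sumr_ge0 => x _; exact: sqr_ge0.
  - rewrite -natrM; apply: (@le_trans _ _ #|C|%:R); last by rewrite ler_nat.
    rewrite -sum1_card natr_sum [leRHS]big_mkcond /=; apply: ler_sum => x _.
    by case: (x \in C); rewrite ?expr1n ?expr0n.
  apply: ler_sum => x _; rewrite sqr_sqrtr ?ler0n // -natr_sum ler_nat.
  rewrite -sum1dep_card big_mkcond /=; apply: leq_sum => j _.
  rewrite /charged; case: ifP => // /andP[h _].
  by have -> : viol j x by move: h; rewrite /active /tracker /nbx /nbS /=.
have half : 1 / 2 <= 1 - n%:R / 2 ^+ k :> R.
  suff : n%:R / 2 ^+ k <= 1 / 2 :> R by lra.
  rewrite ler_pdivrMr ?exprn_gt0 //.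
  suff : (2 * n)%:R <= 2 ^+ k :> R by rewrite natrM; lra.
  by rewrite -natrX ler_nat.
rewrite eB => main.
have h1 : eps * 2 ^+ n <= 16 * k%:R * \sum_x Num.sqrt (a x).
  have : eps * 2 ^+ n * (1 / 2) <= eps * 2 ^+ n * (1 - n%:R / 2 ^+ k).
    by apply: ler_wpM2l => //; rewrite mulr_ge0 // ltW.
  have -> : eps * 2 ^+ n * (1 - n%:R / 2 ^+ k) = eps * (1 - n%:R / 2 ^+ k) * 2 ^+ n by ring.
  move=> /le_trans /(_ main).
  have -> : k%:R * (8 * (2 ^+ n * \sum_x Num.sqrt (a x)) / 2 ^+ n) =
            8 * k%:R * \sum_x Num.sqrt (a x).
    by field; rewrite ?gt_eqF.
  by lra.
have s0 : 0 <= \sum_x Num.sqrt (a x) by apply: sumr_ge0 => x _; exact: sqrtr_ge0.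
apply: (@le_trans _ _ ((16 * k%:R * \sum_x Num.sqrt (a x)) ^+ 2)).
  by rewrite ler_sqr // nnegrE !mulr_ge0 // (ltW n2).
rewrite exprMn; apply: (@le_trans _ _ ((16 * k%:R) ^+ 2 * (2 * #|E|%:R * violations))).
  by apply: ler_wpM2l => //; exact: sqr_ge0.
by rewrite le_eqVlt; apply/orP; left; apply/eqP; ring.
Qed.

End Margulis.

(** * Persistence under random one-sided noise *)

Section Persistence.
Variables (R : realType) (n : nat) (f : cube n -> bool) (q : R).
Hypothesis q01 : 0 <= q <= 1.
Implicit Types (x y D : cube n) (i j : 'I_n) (b : bool) (E : {set cube n * 'I_n}).

Definition weight D : R := \prod_i (if D i then q else 1 - q).

Lemma weight_ge0 D : 0 <= weight D.
Proof.
by have /andP[? ?] := q01; apply: prodr_ge0 => i _; case: (D i); rewrite ?subr_ge0.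
Qed.

Lemma sum_weight : \sum_D weight D = 1.
Proof.
rewrite /weight -(bigA_distr_bigA (fun (i : 'I_n) (a : bool) => if a then q else 1 - q)) /=.
by rewrite big1 // => i _; rewrite big_bool /=; lra.
Qed.

Lemma weight_flip j D : D j -> q * weight (flip j D) = (1 - q) * weight D.
Proof.
move=> Dj; rewrite /weight (bigD1 j) //= [in RHS](bigD1 j) //= flip_same Dj /= mulrCA.
congr (_ * (_ * _)); apply: eq_bigr => i ij; by rewrite flip_other.
Qed.

Lemma weight_indep j (F : cube n -> R) : (forall D, F (flip j D) = F D) ->
  \sum_D weight D * ((D j)%:R * F D) = q * \sum_D weight D * F D.
Proof.
move=> hF.
suff: \sum_D (weight D * ((D j)%:R * F D) +
        weight (flip j D) * ((flip j D j)%:R * F (flip j D))) =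
      \sum_D (q * (weight D * F D) + q * (weight (flip j D) * F (flip j D))).
  rewrite !big_split /= (sum_flip j (fun D => weight D * ((D j)%:R * F D))).
  rewrite (sum_flip j (fun D => q * (weight D * F D))) -mulr_sumr; lra.
apply: eq_bigr => D _; rewrite hF flip_same.
case: (boolP (D j)) => Dj /=.
  by rewrite mulrA (mulrA q (weight (flip j D))) weight_flip //; ring.
have := @weight_flip j (flip j D); rewrite flipK flip_same Dj => /(_ isT) h.
by rewrite mulrA (mulrA q (weight D)) h; ring.
Qed.

Definition prefix_fill b (m : nat) D x : cube n :=
  [ffun k : 'I_n => if (k < m)%N && D k then b else x k].

Definition fill b D x : cube n := [ffun k => if D k then b else x k].

Lemma prefix_fill0 b D x : prefix_fill b 0 D x = x.
Proof. by apply/ffunP => k; rewrite ffunE. Qed.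

Lemma prefix_fill_full b D x : prefix_fill b n D x = fill b D x.
Proof. by apply/ffunP => k; rewrite !ffunE ltn_ord. Qed.

Lemma prefix_fill_flip b j D x : prefix_fill b j (flip j D) x = prefix_fill b j D x.
Proof.
apply/ffunP => k; rewrite !ffunE; case: ltnP => //= kj.
by case: eqP => // e; move: kj; rewrite e ltnn.
Qed.

Lemma prefix_fillS b j D x : prefix_fill b j.+1 D x =
  if D j && (x j != b) then flip j (prefix_fill b j D x) else prefix_fill b j D x.
Proof.
apply/ffunP => k; case: (eqVneq k j) => [->|kj].
  case: ifP; rewrite ?flip_same !ffunE ltnSn ltnn /=;
    by case: (D j); case: (x j); case: b.
have -> : (if D j && (x j != b) then flip j (prefix_fill b j D x)
           else prefix_fill b j D x) k = prefix_fill b j D x k.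
  by case: ifP => // _; rewrite flip_other.
rewrite !ffunE ltnS leq_eqVlt.
by have /negbTE -> : val k != val j by apply: contraNneq kj => /val_inj ->.
Qed.

Definition sgn b : R := if b then 1 else -1.

(** A change against the orientation contributes -1 to the telescoping term, whence the factor 2 on
    violations. *)
Lemma fill_change_step b j D x :
  (f (prefix_fill b j.+1 D x) != f (prefix_fill b j D x))%:R <=
  sgn b * ((f (prefix_fill b j.+1 D x))%:R - (f (prefix_fill b j D x))%:R) +
  2 * ((D j)%:R * (viol f j (prefix_fill b j D x))%:R) :> R.
Proof.
rewrite prefix_fillS; case: ifP => [/andP[Dj xb]|_]; last first.
  by rewrite eqxx subrr mulr0 add0r mulr_ge0 // mulr_ge0.
have yj : prefix_fill b j D x j = ~~ b.
  by rewrite ffunE ltnn /=; move: xb; case: (x j); case: b.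
rewrite /viol Dj yj /sgn.
by case: b {xb yj}; case: (f (flip _ _)); case: (f _); rewrite /=; lra.
Qed.

Lemma fill_change b D x :
  (f (fill b D x) != f x)%:R <=
  sgn b * ((f (fill b D x))%:R - (f x)%:R) +
  2 * \sum_j (D j)%:R * (viol f j (prefix_fill b j D x))%:R :> R.
Proof.
suff H m (le_mn : (m <= n)%N) : (f (prefix_fill b m D x) != f x)%:R <=
    sgn b * ((f (prefix_fill b m D x))%:R - (f x)%:R) +
    2 * \sum_(j < n | (j < m)%N) (D j)%:R * (viol f j (prefix_fill b j D x))%:R :> R.
  have := H n (leqnn n); rewrite prefix_fill_full.
  by under eq_bigl do rewrite ltn_ord.
elim: m le_mn => [_|m IH lt_mn].
  by rewrite prefix_fill0 eqxx subrr mulr0 add0r mulr_ge0 // sumr_ge0 // => j _; rewrite mulr_ge0.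
pose i := Ordinal lt_mn.
rewrite (bigD1 i) //=.
have -> : \sum_(j < n | (j < m.+1)%N && (j != i)) (D j)%:R * (viol f j (prefix_fill b j D x))%:R =
  \sum_(j < n | (j < m)%N) (D j)%:R * (viol f j (prefix_fill b j D x))%:R :> R.
  by apply: eq_bigl => j; rewrite ltnS -val_eqE /= andbC -ltn_neqAle.
have := IH (ltnW lt_mn); have /= := fill_change_step b i D x.
set s := \sum_(j < n | _) _; set A := f (prefix_fill b m.+1 D x); set B := f (prefix_fill b m D x).
set v := _ * _%:R => h1 h2.
have h3 : (A != f x)%:R <= (A != B)%:R + (B != f x)%:R :> R.
  by rewrite -natrD ler_nat; case: (A); case: (B); case: (f x).
apply: le_trans h3 _; apply: le_trans (lerD h1 h2) _.
by rewrite le_eqVlt; apply/orP; left; apply/eqP; ring.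
Qed.

Definition nonpersistent b : R := \sum_x \sum_D weight D * (f (fill b D x) != f x)%:R.

Definition shifted_violations b : R :=
  \sum_j \sum_x \sum_D weight D * (viol f j (prefix_fill b j D x))%:R.

Definition shift b : R := \sum_x \sum_D weight D * (f (fill b D x))%:R - \sum_x (f x)%:R.

(* Each step of the noise that changes [f] against the orientation crosses a  *)
(* violated edge; the other changes telescope.                                *)
Lemma nonpersistent_le_shift b :
  nonpersistent b <= sgn b * shift b + 2 * q * shifted_violations b.
Proof.
have -> : shift b = \sum_x \sum_D weight D * ((f (fill b D x))%:R - (f x)%:R).
  rewrite /shift -sumrB; apply: eq_bigr => x _.
  under [RHS]eq_bigr do rewrite mulrBr.
  by rewrite sumrB -mulr_suml sum_weight mul1r.
have -> : 2 * q * shifted_violations b = \sum_x \sum_D weight D *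
    (2 * \sum_j (D j)%:R * (viol f j (prefix_fill b j D x))%:R).
  rewrite /shifted_violations exchange_big /= mulr_sumr; apply: eq_bigr => x _.
  transitivity (\sum_j 2 * (q * \sum_D weight D * (viol f j (prefix_fill b j D x))%:R)).
    by rewrite mulr_sumr; apply: eq_bigr => j _; rewrite mulrA.
  transitivity (\sum_j \sum_D weight D * (2 * ((D j)%:R * (viol f j (prefix_fill b j D x))%:R))).
    apply: eq_bigr => j _.
    rewrite -(weight_indep (j := j) (F := fun D => (viol f j (prefix_fill b j D x))%:R)); last first.
      by move=> D; rewrite prefix_fill_flip.
    by rewrite mulr_sumr; apply: eq_bigr => D _; rewrite mulrCA.
  rewrite exchange_big /=; apply: eq_bigr => D _.
  by rewrite !mulr_sumr.
rewrite mulr_sumr -big_split /=; apply: ler_sum => x _.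
rewrite mulr_sumr -big_split /=; apply: ler_sum => D _.
rewrite mulrCA -mulrDr; apply: ler_wpM2l; first exact: weight_ge0.
exact: fill_change.
Qed.

(** The density, relative to the uniform law, of a uniform point after the noise. *)
Definition density b y : R := \prod_i (if y i == b then 1 + q else 1 - q).

Lemma densityE b y : \sum_x \sum_D weight D * (fill b D x == y)%:R = density b y.
Proof.
transitivity (\sum_(x : cube n) \sum_(D : cube n) \prod_i
   ((if D i then q else 1 - q) * ((if D i then b else x i) == y i)%:R)).
  apply: eq_bigr => x _; apply: eq_bigr => D _; rewrite big_split /=; congr (_ * _).
  case: eqP => [<-|ne].
    by rewrite big1 // => i _; rewrite ffunE eqxx.
  have [i hi] : exists i, fill b D x i != y i.
    apply/existsP; apply: contraT; rewrite negb_exists => /forallP h.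
    by case: ne; apply/ffunP => i; apply/eqP; have := h i; rewrite negbK.
  by rewrite (bigD1 i) //= -[if D i then b else x i](ffunE (fun k => if D k then b else x k))
     (negbTE hi) mul0r.
transitivity (\sum_(x : cube n) \prod_i \sum_(d : bool)
   ((if d then q else 1 - q) * ((if d then b else x i) == y i)%:R)).
  apply: eq_bigr => x _.
  by rewrite (bigA_distr_bigA (fun (i : 'I_n) (d : bool) =>
    (if d then q else 1 - q) * ((if d then b else x i) == y i)%:R)).
rewrite -(bigA_distr_bigA (fun (i : 'I_n) (a : bool) => \sum_(d : bool)
   ((if d then q else 1 - q) * ((if d then b else a) == y i)%:R))) /=.
apply: eq_bigr => i _; rewrite !big_bool /=.
by case: (y i); case: b => /=; ring.
Qed.

Lemma shiftE b : shift b = \sum_y (f y)%:R * (density b y - 1).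
Proof.
under [RHS]eq_bigr do rewrite mulrBr mulr1.
rewrite sumrB; congr (_ - _).
under [RHS]eq_bigr do rewrite -densityE mulr_sumr.
rewrite [RHS]exchange_big /=; apply: eq_bigr => x _.
under [RHS]eq_bigr do rewrite mulr_sumr.
rewrite exchange_big /=; apply: eq_bigr => D _.
rewrite (bigD1 (fill b D x)) //= eqxx mulr1 big1 ?addr0 1?mulrC // => y ne.
by rewrite eq_sym (negbTE ne) !mulr0.
Qed.

Lemma sum_density b : \sum_y density b y = 2 ^+ n.
Proof.
rewrite /density -(bigA_distr_bigA (fun (i : 'I_n) (a : bool) => if a == b then 1 + q else 1 - q)) /=.
rewrite -[n in RHS]card_ord -prodr_const; apply: eq_bigr => i _.
by rewrite big_bool; case: b => /=; ring.
Qed.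

Lemma sum_density_sqr b : \sum_y density b y ^+ 2 = 2 ^+ n * (1 + q ^+ 2) ^+ n.
Proof.
under eq_bigr do rewrite /density -prodrXl.
rewrite -(bigA_distr_bigA (fun (i : 'I_n) (a : bool) => (if a == b then 1 + q else 1 - q) ^+ 2)) /=.
rewrite -exprMn -[n in RHS]card_ord -prodr_const; apply: eq_bigr => i _.
by rewrite big_bool; case: b => /=; ring.
Qed.

Lemma expr1D_le (a : R) (m : nat) : 0 <= a -> m%:R * a <= 1 / 2 ->
  (1 + a) ^+ m <= 1 + 2 * (m%:R * a).
Proof.
move=> a0; elim: m => [|m IH]; first by rewrite expr0 mul0r mulr0 addr0.
rewrite -natr1 mulrDl mul1r => h.
have m0 : 0 <= m%:R * a by rewrite mulr_ge0.
have {}IH := IH ltac:(lra).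
rewrite exprS; apply: (@le_trans _ _ ((1 + a) * (1 + 2 * (m%:R * a)))).
  by rewrite ler_wpM2l // addr_ge0.
by nra.
Qed.

(** Cauchy-Schwarz against [density - 1], whose squared norm is [2 ^ n * ((1 + q ^ 2) ^ n - 1)], at
    most [2 ^ n * 2 * n * q ^ 2]; the constant 3/2 is a rational bound for the square root of 2. *)
Lemma shift_le b : n%:R * q ^+ 2 <= 1 / 2 ->
  `|shift b| <= 2 ^+ n * (3 / 2 * (q * Num.sqrt n%:R)).
Proof.
have /andP[q0 _] := q01.
have n2 : 0 <= (2 : R) ^+ n by rewrite exprn_ge0.
move=> hq; rewrite -ler_sqr ?nnegrE ?normr_ge0 ?mulr_ge0 ?sqrtr_ge0 //; last by lra.
rewrite real_normK ?num_real // shiftE.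
apply: le_trans (cauchy_schwarz _ _) _.
have -> : \sum_y (density b y - 1) ^+ 2 = 2 ^+ n * ((1 + q ^+ 2) ^+ n - 1).
  under eq_bigr do rewrite sqrrB1.
  rewrite big_split /= sumrB sum_density_sqr.
  under [X in _ - X]eq_bigr do rewrite -[_ *+ 2]mulr_natr.
  rewrite -mulr_suml sum_density sumr_const card_cube -[1 *+ _]/(_%:R) natrX; ring.
have h1 : \sum_y (f y)%:R ^+ 2 <= 2 ^+ n :> R.
  rewrite -natrX -card_cube -sum1_card natr_sum; apply: ler_sum => y _.
  by case: (f y); rewrite ?expr1n ?expr0n.
have h2 : (1 + q ^+ 2) ^+ n - 1 <= 2 * (n%:R * q ^+ 2).
  by have := expr1D_le (sqr_ge0 q) hq; lra.
apply: (@le_trans _ _ (2 ^+ n * (2 ^+ n * (2 * (n%:R * q ^+ 2))))).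
  apply: ler_pM => //.
  - by apply: sumr_ge0 => y _; exact: sqr_ge0.
  - rewrite mulr_ge0 // subr_ge0 exprn_ege1 // lerDl sqr_ge0 //.
  by rewrite ler_wpM2l.
have : 0 <= 2 ^+ n * 2 ^+ n * (n%:R * q ^+ 2) :> R by rewrite !mulr_ge0 ?sqr_ge0.
set t := 2 ^+ n * 2 ^+ n * _ => t0.
have -> : 2 ^+ n * (2 ^+ n * (2 * (n%:R * q ^+ 2))) = 2 * t by rewrite /t; ring.
have -> : (2 ^+ n * (3 / 2 * (q * Num.sqrt n%:R))) ^+ 2 = 9 / 4 * t.
  rewrite /t -[X in X * q ^+ 2](sqr_sqrtr (ler0n R n)).
  by set s := Num.sqrt _; field.
by lra.
Qed.

Lemma nonpersistent_le b : n%:R * q ^+ 2 <= 1 / 2 ->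
  nonpersistent b <= 2 ^+ n * (3 / 2 * (q * Num.sqrt n%:R)) + 2 * q * shifted_violations b.
Proof.
move=> /(shift_le b) h; apply: le_trans (nonpersistent_le_shift b) _.
rewrite lerD2r; move: h; rewrite ler_norml /sgn => /andP[]; case: b; lra.
Qed.

Definition caught : R :=
  \sum_x \sum_D weight D * (f (fill false D x) && ~~ f (fill true D x))%:R.

Lemma sum_inj_le (I T : finType) (A : {set I}) (g : I -> T) (F : T -> R) :
  {in A &, injective g} -> (forall t, 0 <= F t) ->
  \sum_(i in A) F (g i) <= \sum_t F t.
Proof.
move=> gi F0; rewrite -(big_imset F gi) /= [leRHS](bigID (mem (g @: A))) /= lerDl.
exact: sumr_ge0.
Qed.

(** If the noise hits the direction of a matched edge, both endpoints have the same upper fill;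
    persistence of the lower endpoint under 0-noise and of the upper one under 1-noise then makes
    the two ends of the noise a violated pair. *)
Lemma caught_ge E : {in E, forall p, violated_edge f p} ->
  {in E &, injective fst} -> {in E &, injective (@upper n)} ->
  q * (#|E|%:R - nonpersistent false - nonpersistent true) <= caught.
Proof.
move=> vE i1 i2; have /andP[q0 _] := q01.
pose N b x : R := \sum_D weight D * (f (fill b D x) != f x)%:R.
have N0 b x : 0 <= N b x.
  by apply: sumr_ge0 => D _; rewrite mulr_ge0 // weight_ge0.
have C0 x : 0 <= \sum_D weight D * (f (fill false D x) && ~~ f (fill true D x))%:R.
  by apply: sumr_ge0 => D _; rewrite mulr_ge0 // weight_ge0.
apply: (@le_trans _ _ (q * \sum_(p in E) (1 - N false p.1 - N true (upper p)))).
  apply: ler_wpM2l => //; rewrite !sumrB sumr_const.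
  exact: lerB (lerB (lexx _) (sum_inj_le i1 (N0 false))) (sum_inj_le i2 (N0 true)).
rewrite mulr_sumr.
apply: le_trans (sum_inj_le i1 C0); apply: ler_sum => p pE.
have := vE p pE; rewrite violated_edgeE; case: p {pE} => u j /=.
rewrite /upper /= => /and3P[fu nfv nuj].
(* The 0-fill of [u] and the 1-fill of [flip j u] ignore the bit [D j], so persistence is
   independent of the event that [j] is hit. *)
pose F D : R := 1 - (f (fill false D u) != f u)%:R - (f (fill true D (flip j u)) != f (flip j u))%:R.
have hF D : F (flip j D) = F D.
  rewrite /F; have -> : fill false (flip j D) u = fill false D u.
    apply/ffunP => k; rewrite !ffunE; case: eqP => // ->.
    by rewrite (negbTE nuj); case: (D j).
  have -> // : fill true (flip j D) (flip j u) = fill true D (flip j u).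
  apply/ffunP => k; rewrite !ffunE; case: eqP => // ->.
  by rewrite nuj; case: (D j).
have -> : 1 - N false u - N true (flip j u) = \sum_D weight D * F D.
  under [RHS]eq_bigr do rewrite !mulrBr mulr1.
  by rewrite !sumrB sum_weight.
rewrite -(weight_indep hF); apply: ler_sum => D _; apply: ler_wpM2l; first exact: weight_ge0.
case: (boolP (D j)) => Dj /=; last by rewrite mul0r.
have -> : fill true D u = fill true D (flip j u).
  by apply/ffunP => k; rewrite !ffunE; case: eqP => // ->; rewrite Dj.
rewrite mul1r /F fu (negbTE nfv).
by case: (f _); case: (f _) => /=; lra.
Qed.

End Persistence.

(** * The tester *)

Section Repetition.
Variables (R : realType) (n : nat) (T : finType) (l : T -> R) (z w : T -> cube n) (N : nat).
Hypotheses (l_ge0 : forall t, 0 <= l t) (l_sum1 : \sum_t l t = 1).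
Hypothesis zw : forall t i, (z t i <= w t i)%N.

Fixpoint no_descent (s : seq bool) : bool :=
  if s is a :: b :: s' then ~~ (a && ~~ b) && no_descent s' else true.

Definition pair_queries (s : seq T) : seq (cube n) :=
  flatten [seq [:: z t; w t] | t <- s].

Definition rlaw (t : {ffun 'I_N -> T}) : R := \prod_i l (t i).

Lemma rlaw_ge0 t : 0 <= rlaw t.
Proof. exact: prodr_ge0. Qed.

Lemma rlaw_sum1 : \sum_t rlaw t = 1.
Proof.
rewrite /rlaw -(bigA_distr_bigA (fun (_ : 'I_N) t => l t)) /=.
by rewrite big1.
Qed.

Definition repeated_test : nonadaptive_algorithm R n :=
  NonadaptiveAlgorithm rlaw_ge0 rlaw_sum1
    (fun t : {ffun 'I_N -> T} => pair_queries [seq t i | i <- enum 'I_N])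
    (fun _ => no_descent).

Definition rejects (f : cube n -> bool) t := f (z t) && ~~ f (w t).

Lemma no_descentE f s :
  no_descent [seq f x | x <- pair_queries s] = all (fun t => ~~ rejects f t) s.
Proof. by elim: s => //= t s <-. Qed.

Lemma output_repeated f (t : {ffun 'I_N -> T}) :
  output (A := repeated_test) f t = [forall i, ~~ rejects f (t i)].
Proof.
rewrite /output /= no_descentE all_map; apply/allP/forallP => h i; last by move=> _; exact: h.
by apply: h; rewrite mem_enum.
Qed.

Lemma repeated_always_yes f : monotone f -> always_yes repeated_test f.
Proof.
move=> mf t; rewrite output_repeated; apply/forallP => i.
rewrite /rejects; have [->|/eqP ne] := eqVneq (z (t i)) (w (t i)); first by case: (f _).
have : prec (z (t i)) (w (t i)) by split=> // j; exact: zw.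
by move/mf; case: (f _); case: (f _).
Qed.

Lemma repeated_complexity : (query_complexity repeated_test <= 2 * N)%N.
Proof.
apply/bigmax_leqP => t _ /=.
have -> s : size (pair_queries s) = (2 * size s)%N.
  by elim: s => //= u s IH; rewrite -/(pair_queries s) IH mulnS.
by rewrite size_map size_enum_ord.
Qed.

Lemma repeated_prob_no f : prob_no repeated_test f =
  1 - (1 - \sum_t l t * (rejects f t)%:R) ^+ N.
Proof.
have <- : \sum_(t | ~~ rejects f t) l t = 1 - \sum_t l t * (rejects f t)%:R.
  rewrite -[X in X - _]l_sum1 -sumrB big_mkcond /=; apply: eq_bigr => t _.
  by case: (rejects f t); rewrite ?mulr1 ?mulr0 ?subrr ?subr0.
rewrite -[N in _ ^+ N]card_ord -prodr_const bigA_distr_big /=.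
rewrite -[X in X - _]rlaw_sum1 (bigID (fun t => output (A := repeated_test) f t)) /=.
rewrite [X in _ - X](eq_bigl (fun t => output (A := repeated_test) f t)); last first.
  by move=> t; rewrite output_repeated; apply/ffun_onP/forallP => h i; exact: h.
rewrite addrAC subrr add0r /prob_no; apply: eq_bigl => t.
by rewrite eqbF_neg.
Qed.

(** Since [(1 - r) * (1 + d) <= 1], Bernoulli's inequality bounds the acceptance probability by
    [1 / (1 + N d) <= 1 / 3]. *)
Lemma repeated_prob_no_ge (d : R) f : 0 <= d -> 2 <= N%:R * d ->
  d <= \sum_t l t * (rejects f t)%:R -> 2 / 3 <= prob_no repeated_test f.
Proof.
move=> d0 Nd; rewrite repeated_prob_no; set r := \sum_t _ => dr.
have r1 : r <= 1.
  rewrite -[leRHS]l_sum1; apply: ler_sum => t _; rewrite ler_piMr //.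
  by case: (rejects f t).
suff : (1 - r) ^+ N <= 1 / 3 by lra.
have bern m : 1 + m%:R * d <= (1 + d) ^+ m.
  elim: m => [|m IH]; first by rewrite mul0r addr0.
  rewrite -natr1 exprS; apply: (@le_trans _ _ ((1 + d) * (1 + m%:R * d))).
    have : 0 <= m%:R * d * d by rewrite !mulr_ge0.
    by lra.
  by rewrite ler_wpM2l // addr_ge0.
have h1 : (1 - r) ^+ N * (1 + d) ^+ N <= 1.
  rewrite -exprMn exprn_ile1 //; first by rewrite mulr_ge0 ?subr_ge0 // addr_ge0.
  by nra.
have h2 := bern N.
have h3 : 0 <= (1 - r) ^+ N by rewrite exprn_ge0 // subr_ge0.
by nra.
Qed.

End Repetition.

(** * The random pair of comparable queries *)

Section PairTest.
Variables (R : realType) (n : nat) (q : R).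
Hypothesis q01 : 0 <= q <= 1.
Hypothesis n_gt0 : (0 < n)%N.

Definition pair_seed : finType := (bool * bool * (cube n * cube n * 'I_n))%type.

Definition pair_law (t : pair_seed) : R :=
  let: (_, (_, D, _)) := t in weight q D / (4 * n%:R * 2 ^+ n).

Definition edge_low j (y : cube n) := if y j then flip j y else y.
Definition edge_high j (y : cube n) := if y j then y else flip j y.

(* The two bits choose between the three kinds of pairs: an edge reached by   *)
(* noise on the coordinates before it, the two ends of the noise, an edge.    *)
Definition pair_low (t : pair_seed) : cube n :=
  let: (a, b, (x, D, j)) := t in
  if a then edge_low j (prefix_fill b j D x)
  else if b then fill false D x else edge_low j x.

Definition pair_high (t : pair_seed) : cube n :=
  let: (a, b, (x, D, j)) := t in
  if a then edge_high j (prefix_fill b j D x)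
  else if b then fill true D x else edge_high j x.

Lemma pair_law_ge0 t : 0 <= pair_law t.
Proof.
case: t => p [[x D] j]; rewrite /pair_law divr_ge0 ?weight_ge0 //.
by rewrite !mulr_ge0 // exprn_ge0.
Qed.

Lemma sum_pair_seed (F : pair_seed -> R) :
  \sum_t F t = \sum_a \sum_b \sum_x \sum_D \sum_j F (a, b, (x, D, j)).
Proof.
transitivity (\sum_(t : pair_seed) F (t.1.1, t.1.2, (t.2.1.1, t.2.1.2, t.2.2))).
  by apply: eq_bigr => -[[a b] [[x D] j]].
rewrite -(pair_bigA _ (fun p r => F (p.1, p.2, (r.1.1, r.1.2, r.2)))) /=.
rewrite -(pair_bigA _ (fun a b => \sum_(r : cube n * cube n * 'I_n) F (a, b, (r.1.1, r.1.2, r.2)))) /=.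
apply: eq_bigr => a _; apply: eq_bigr => b _.
rewrite -(pair_bigA _ (fun p j => F (a, b, (p.1, p.2, j)))) /=.
by rewrite -(pair_bigA _ (fun x D => \sum_j F (a, b, (x, D, j)))).
Qed.

Lemma edge_le j y i : (edge_low j y i <= edge_high j y i)%N.
Proof.
rewrite /edge_low /edge_high; case: (boolP (y j)) => yj; rewrite flipE;
  by case: eqP => // ->; rewrite ?yj // (negbTE yj).
Qed.

Lemma pair_le t i : (pair_low t i <= pair_high t i)%N.
Proof.
case: t => [[a b] [[x D] j]] /=; case: a; first exact: edge_le.
case: b; last exact: edge_le.
by rewrite !ffunE; case: (D i).
Qed.

Lemma edge_viol (f : cube n -> bool) j y :
  f (edge_low j y) && ~~ f (edge_high j y) = viol f j y.
Proof.
rewrite /edge_low /edge_high /viol.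
by case: (y j); case: (f y); case: (f _).
Qed.

Let n_neq0 : n%:R != 0 :> R. Proof. by rewrite pnatr_eq0 -lt0n. Qed.
Let p2_neq0 : 2 ^+ n != 0 :> R. Proof. by rewrite expf_neq0 // pnatr_eq0. Qed.

Lemma sum_pair_law : \sum_t pair_law t = 1.
Proof.
rewrite sum_pair_seed /=.
have e : \sum_(D : cube n) \sum_(j < n) weight q D / (4 * n%:R * 2 ^+ n) = (4 * 2 ^+ n)^-1 :> R.
  under eq_bigr do rewrite sumr_const card_ord -(mulr_natr (weight q _ / _) n) -mulrA.
  rewrite -mulr_suml sum_weight mul1r.
  by field; rewrite n_neq0 p2_neq0.
have e' : \sum_(x : cube n) (4 * 2 ^+ n)^-1 = 1 / 4 :> R.
  rewrite sumr_const card_cube -(mulr_natr _ (2 ^ n)) natrX.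
  by field; rewrite p2_neq0.
under eq_bigr do under eq_bigr do under eq_bigr do rewrite e.
by rewrite !big_bool /= !e'; lra.
Qed.

Lemma pair_rejects f :
  \sum_t pair_law t * (rejects pair_low pair_high f t)%:R =
  (shifted_violations f q true + shifted_violations f q false
   + n%:R * caught f q + violations R f) / (4 * n%:R * 2 ^+ n).
Proof.
pose Z : R := (4 * n%:R * 2 ^+ n)^-1.
have scale (F : cube n -> cube n -> 'I_n -> R) :
    \sum_x \sum_D \sum_j weight q D / (4 * n%:R * 2 ^+ n) * F x D j =
    (\sum_x \sum_D \sum_j weight q D * F x D j) * Z.
  rewrite mulr_suml; apply: eq_bigr => x _; rewrite mulr_suml; apply: eq_bigr => D _.
  by rewrite mulr_suml; apply: eq_bigr => j _; rewrite mulrAC.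
rewrite sum_pair_seed !big_bool /= !scale -!mulrDl; congr (_ * _).
rewrite /rejects /=.
under eq_bigr do under eq_bigr do under eq_bigr do rewrite edge_viol.
under [X in _ + X + _]eq_bigr do under eq_bigr do under eq_bigr do rewrite edge_viol.
under [X in _ + _ + (_ + X)]eq_bigr do under eq_bigr do under eq_bigr do rewrite edge_viol.
rewrite -!addrA; congr (_ + _).
  rewrite /shifted_violations [RHS]exchange_big; apply: eq_bigr => x _.
  by rewrite exchange_big.
congr (_ + _).
  rewrite /shifted_violations [RHS]exchange_big; apply: eq_bigr => x _.
  by rewrite exchange_big.
congr (_ + _).
  rewrite /caught mulr_sumr; apply: eq_bigr => x _; rewrite mulr_sumr; apply: eq_bigr => D _.
  by rewrite sumr_const card_ord mulr_natl.
rewrite /violations; apply: eq_bigr => x _; rewrite exchange_big; apply: eq_bigr => j _ /=.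
by rewrite -mulr_suml sum_weight mul1r.
Qed.

End PairTest.

(** * The rejection probability of one pair *)

Section Detection.
Variables (R : realType) (n : nat) (f : cube n -> bool) (eps a : R) (k : nat).
Hypotheses (n_gt0 : (0 < n)%N) (hk : (2 * n <= 2 ^ k)%N).
Hypotheses (a_ge1 : 1 <= a) (a6 : a ^+ 6 = n%:R) (eps01 : 0 < eps < 1).

(* [a] stands for [n ^ (1/6)].  If there are at most [a * 2 ^+ n] violated     *)
(* edges, the directed Margulis inequality yields a matching of density       *)
(* [matching_density]; [bias] makes the expected noise length proportional to *)
(* this density times [sqrt n], so that most matched vertices are persistent. *)
Definition matching_density : R := eps ^+ 2 / (512 * k%:R ^+ 2 * a).
Definition bias : R := matching_density / (12 * a ^+ 3).

Let s := matching_density.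
Let q := bias.

Let a_gt0 : 0 < a. Proof. exact: lt_le_trans ltr01 a_ge1. Qed.
Let p2_gt0 : 0 < 2 ^+ n :> R. Proof. by rewrite exprn_gt0. Qed.
Let a3_gt0 : 0 < a ^+ 3. Proof. by rewrite exprn_gt0. Qed.
Let a3_ge1 : 1 <= a ^+ 3. Proof. exact: exprn_ege1. Qed.

Let k_ge1 : 1 <= k%:R :> R.
Proof.
rewrite ler1n lt0n; apply: contraTneq hk => ->.
by rewrite expn0 -ltnNge leq_pmulr.
Qed.

Lemma sqrt_n : Num.sqrt n%:R = a ^+ 3.
Proof. by rewrite -a6 (exprM a 3 2) sqrtr_sqr ger0_norm // ltW. Qed.

Lemma matching_density_gt0 : 0 < s.
Proof.
have /andP[e0 _] := eps01.
have k0 : 0 < k%:R :> R by have := k_ge1; lra.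
by rewrite divr_gt0 ?mulr_gt0 ?exprn_gt0.
Qed.

Lemma matching_density_le : s * a <= 1.
Proof.
have /andP[e0 e1] := eps01.
have k0 : 0 < k%:R :> R by have := k_ge1; lra.
have k2 : 1 <= k%:R ^+ 2 :> R by exact: exprn_ege1.
have -> : s * a = eps ^+ 2 / (512 * k%:R ^+ 2).
  by rewrite /s /matching_density; field; rewrite !gt_eqF.
rewrite ler_pdivrMr; last by lra.
by apply: (@le_trans _ _ 1); [rewrite expr_le1 //; lra | lra].
Qed.

Let s_le1 : s <= 1.
Proof.
by apply: le_trans matching_density_le; rewrite ler_peMr // ltW // matching_density_gt0.
Qed.

Lemma bias01 : 0 <= q <= 1.
Proof.
have s0 := matching_density_gt0.
have h : 0 < 12 * a ^+ 3 by exact: mulr_gt0.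
apply/andP; split; first exact: divr_ge0 (ltW s0) (ltW h).
by rewrite /q /bias (ler_pdivrMr _ _ h) -/s; have := a3_ge1; have := s_le1; lra.
Qed.

Lemma bias_a3 : q * a ^+ 3 = s / 12.
Proof. by rewrite /q /bias -/s; field; rewrite gt_eqF. Qed.

Lemma pair_test_detects : far_from_monotone eps f ->
  s ^+ 2 / (96 * a ^+ 3) <=
  (shifted_violations f q true + shifted_violations f q false
   + n%:R * caught f q + violations R f) / (4 * n%:R * 2 ^+ n).
Proof.
move=> far; have /andP[e0 e1] := eps01.
have s0 : 0 < s := matching_density_gt0.
have q01 := bias01; have /andP[q0 q1] := q01.
have a0 := a_gt0; have a30 := a3_gt0; have k0 : 0 < k%:R :> R by have := k_ge1; lra.
have s2 : s ^+ 2 <= 1 by exact: exprn_ile1 (ltW s0) s_le1.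
set t1 := shifted_violations f q true; set t0 := shifted_violations f q false.
set C := caught f q; set V := violations R f.
have sv_ge0 b : 0 <= shifted_violations f q b.
  apply: sumr_ge0 => j _; apply: sumr_ge0 => x _; apply: sumr_ge0 => D _.
  by rewrite mulr_ge0 // weight_ge0.
have C0 : 0 <= C.
  by apply: sumr_ge0 => x _; apply: sumr_ge0 => D _; rewrite mulr_ge0 // weight_ge0.
have V0 : 0 <= V by apply: sumr_ge0 => x _; apply: sumr_ge0.
have t10 : 0 <= t1 := sv_ge0 true.
have t00 : 0 <= t0 := sv_ge0 false.
have n0 : 0 < n%:R :> R by rewrite ltr0n.
rewrite ler_pdivlMr ?mulr_gt0 //.
have -> : s ^+ 2 / (96 * a ^+ 3) * (4 * n%:R * 2 ^+ n) = s ^+ 2 * a ^+ 3 / 24 * 2 ^+ n.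
  by rewrite -a6; field; rewrite gt_eqF.
have nC0 : 0 <= n%:R * C by rewrite mulr_ge0 // ltW.
have [hV|hV] := lerP (a * 2 ^+ n) V.
  apply: (@le_trans _ _ V); last by lra.
  apply: le_trans hV; rewrite ler_pM2r //.
  have : (s * a) ^+ 2 <= 1.
    apply: exprn_ile1; last exact: matching_density_le.
    exact: mulr_ge0 (ltW s0) (ltW a_gt0).
  rewrite exprMn => h.
  have -> : s ^+ 2 * a ^+ 3 / 24 = (s ^+ 2 * a ^+ 2) * (a / 24) by field.
  apply: (@le_trans _ _ (1 * (a / 24))); last by lra.
  by rewrite ler_pM2r // divr_gt0.
have [ht1|ht1] := lerP (3 / 4 * a ^+ 3 * 2 ^+ n) t1.
  apply: (@le_trans _ _ t1); last by lra.
  apply: le_trans ht1; rewrite ler_pM2r // mulrAC ler_pM2r //.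
  by lra.
have [ht0|ht0] := lerP (3 / 4 * a ^+ 3 * 2 ^+ n) t0.
  apply: (@le_trans _ _ t0); last by lra.
  apply: le_trans ht0; rewrite ler_pM2r // mulrAC ler_pM2r //.
  by lra.
have [E [vE i1 i2 cov]] := maximal_matching f.
have hE : s * 2 ^+ n <= #|E|%:R.
  have := directed_margulis hk (ltW e0) far cov; rewrite -/V => hm.
  have k2 : 0 < k%:R ^+ 2 :> R by exact: exprn_gt0.
  have : (eps * 2 ^+ n) ^+ 2 <= 512 * k%:R ^+ 2 * #|E|%:R * (a * 2 ^+ n).
    apply: le_trans hm _; apply: ler_wpM2l; last exact: ltW.
    by rewrite !mulr_ge0 // ltW.
  rewrite exprMn {1}[in X in _ * X <= _]expr2 !mulrA ler_pM2r // => h.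
  rewrite /s /matching_density mulrAC ler_pdivrMr; last by rewrite !mulr_gt0.
  by apply: le_trans h _; rewrite le_eqVlt; apply/orP; left; apply/eqP; ring.
have hq : n%:R * q ^+ 2 <= 1 / 2.
  have -> : n%:R * q ^+ 2 = (q * a ^+ 3) ^+ 2 by rewrite -a6; ring.
  rewrite bias_a3 exprMn.
  by lra.
(* The shift of mass and the crossed violated edges contribute [s / 8] each; the two noises together
   spoil at most half of the matching. *)
have np b : shifted_violations f q b < 3 / 4 * a ^+ 3 * 2 ^+ n ->
    nonpersistent f q b <= s / 4 * 2 ^+ n.
  move=> hb; apply: le_trans (nonpersistent_le f q01 b hq) _.
  rewrite sqrt_n bias_a3.
  have h : 2 * q * shifted_violations f q b <= 2 * q * (3 / 4 * a ^+ 3 * 2 ^+ n).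
    by apply: ler_wpM2l; [rewrite mulr_ge0 | exact: ltW].
  have e : 2 * q * (3 / 4 * a ^+ 3 * 2 ^+ n) = s / 8 * 2 ^+ n.
    have -> : 2 * q * (3 / 4 * a ^+ 3 * 2 ^+ n) = 3 / 2 * (q * a ^+ 3) * 2 ^+ n by field.
    by rewrite bias_a3; field.
  by rewrite e in h; lra.
have hC : q * (s / 2 * 2 ^+ n) <= C.
  apply: le_trans (caught_ge q01 vE i1 i2); apply: ler_wpM2l => //.
  by have := np _ ht0; have := np _ ht1; lra.
apply: (@le_trans _ _ (n%:R * C)); last by lra.
apply: (@le_trans _ _ (n%:R * (q * (s / 2 * 2 ^+ n)))); last by rewrite ler_pM2l.
have -> : n%:R * (q * (s / 2 * 2 ^+ n)) = a ^+ 3 * (q * a ^+ 3) * (s / 2 * 2 ^+ n).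
  by rewrite -a6; ring.
by rewrite bias_a3 le_eqVlt; apply/orP; left; apply/eqP; field.
Qed.

End Detection.

(** * Choice of parameters and query count *)

Section Algorithm.
Variable R : realType.

Definition rate (n : nat) (eps : R) : R := n%:R `^ (5 / 6) * eps ^- 4.

(** Positivity of [eps] is a premise inside the predicate because the family of algorithms is
    indexed by all reals. *)
Definition tests (C : R) (n : nat) (eps : R) (A : nonadaptive_algorithm R n) : Prop :=
  0 < eps ->
  [/\ forall f, monotone f -> always_yes A f,
      forall f, far_from_monotone eps f -> 2 / 3 <= prob_no A f &
      (query_complexity A)%:R <= C * rate n eps * ln (2 + rate n eps) ^+ 4].

Lemma unit_law_sum1 : \sum_(t : unit) (1 : R) = 1.
Proof. by rewrite sumr_const card_unit. Qed.

Definition accept n : nonadaptive_algorithm R n :=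
  NonadaptiveAlgorithm (law := fun _ : unit => 1) (fun=> ler01) unit_law_sum1
    (fun=> [::]) (fun _ _ => true).

Lemma rate_ge0 n (eps : R) : 0 < eps -> 0 <= rate n eps.
Proof. by move=> e0; rewrite mulr_ge0 ?powR_ge0 // invr_ge0 exprn_ge0 // ltW. Qed.

Lemma ln_rate_ge0 n (eps : R) : 0 < eps -> 0 <= ln (2 + rate n eps).
Proof. by move=> e0; rewrite ln_ge0 //; have := rate_ge0 n e0; lra. Qed.

Lemma accept_tests (C : R) n (eps : R) : 0 <= C ->
  (forall f : cube n -> bool, ~ far_from_monotone eps f) -> tests C eps (accept n).
Proof.
move=> C0 nofar e0; split=> [f _ [] //|f /nofar //|].
rewrite /query_complexity big1 //; apply: mulr_ge0; last exact/exprn_ge0/ln_rate_ge0.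
exact: mulr_ge0 C0 (rate_ge0 n e0).
Qed.

Lemma no_far_dim0 (eps : R) (f : cube 0 -> bool) : 0 < eps -> ~ far_from_monotone eps f.
Proof.
move=> e0 far.
have mf : monotone f by move=> x y [_ []]; apply/ffunP => -[].
have := far f mf; rewrite /dist.
have -> : [set x : cube 0 | f x != f x] = set0 by apply/setP => x; rewrite !inE eqxx.
by rewrite cards0 mul0r ltNge (ltW e0).
Qed.

Lemma no_far_eps1 n (eps : R) (f : cube n -> bool) : 1 <= eps -> ~ far_from_monotone eps f.
Proof.
move=> e1 far; have mf : monotone (fun _ : cube n => true) by [].
have := far _ mf; apply/negP; rewrite -leNgt; apply: le_trans e1.
rewrite /dist card_cube ler_pdivrMr ?ltr0n ?expn_gt0 // mul1r ler_nat -card_cube.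
exact: max_card.
Qed.

Definition query_constant : R := 576 * 512 ^+ 2 * (4 / ln 2) ^+ 4.

(** As [n <= g ^ 2] for the rate [g], [2 ^ (k - 1) <= 2 n <= (2 + g) ^ 3]; the missing unit of [k]
    costs one more [ln (2 + g)], so 3 becomes 4. *)
Lemma up_log_rate n (eps : R) : (0 < n)%N -> 0 < eps < 1 ->
  (up_log 2 (2 * n))%:R <= 4 / ln 2 * ln (2 + rate n eps).
Proof.
move=> n0 /andP[e0 e1]; set k := up_log _ _; set g := rate n eps.
have g0 : 0 <= g := rate_ge0 n e0.
have l2 : 0 < ln 2 :> R by rewrite ln_gt0 //; lra.
have n1 : 1 <= n%:R :> R by rewrite ler1n.
have n_le : n%:R <= g ^+ 2.
  have h : n%:R `^ (5 / 6) <= g.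
    rewrite /g /rate ler_peMr ?powR_ge0 // invf_ge1 ?exprn_gt0 //.
    by rewrite exprn_ile1 // ltW.
  apply: (@le_trans _ _ ((n%:R `^ (5 / 6)) ^+ 2)); last first.
    by rewrite ler_sqr ?nnegrE ?powR_ge0.
  rewrite -powR_mulrn ?powR_ge0 // -powRrM -{1}[n%:R]powRr1 //.
  by apply: ler_powR => //; lra.
have h1 : 2 ^+ k.-1 <= (2 + g) ^+ 3.
  apply: (@le_trans _ _ (2 * n%:R)).
    rewrite -natrX -natrM ler_nat ltnW // up_log_gtn //.
    by case: n n0 {k g g0 n1 n_le} => // m _; rewrite mulnS.
  have : 0 <= g ^+ 3 by rewrite exprn_ge0.
  by rewrite !exprS expr0; nra.
have h2 : ln 2 *+ k.-1 <= ln (2 + g) *+ 3.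
  by rewrite -!lnXn ?ler_ln ?posrE ?exprn_gt0 //; lra.
have h3 : ln 2 <= ln (2 + g) by rewrite ler_ln ?posrE; lra.
have h4 : k%:R <= k.-1%:R + 1 :> R by rewrite natr1 ler_nat leqSpred.
rewrite mulrAC ler_pdivlMr //.
apply: (@le_trans _ _ ((k.-1%:R + 1) * ln 2)); first by rewrite ler_pM2r.
rewrite mulrDl mul1r mulr_natl.
by move: h2; rewrite -(mulr_natr (ln (2 + g))); lra.
Qed.

(** A sigma type, so that the algorithms can be projected as a function of [n] and [eps]. *)
Lemma tester n (eps : R) : {A : nonadaptive_algorithm R n | tests query_constant eps A}.
Proof.
have C0 : 0 <= query_constant.
  have l2 : 0 < ln 2 :> R by rewrite ln_gt0 //; lra.
  apply: mulr_ge0; first by apply: mulr_ge0 => //; exact: exprn_ge0.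
  by apply: exprn_ge0; apply: divr_ge0 => //; exact: ltW.
have [eps01|neps] := boolP (0 < eps < 1); last first.
  exists (accept n) => e0; apply: accept_tests => // f; apply: no_far_eps1.
  by rewrite leNgt; apply: contraNN neps => ->; rewrite e0.
have [n0|] := ltnP 0 n; last first.
  case: n => // _; exists (accept 0) => e0; apply: accept_tests => // f.
  exact: no_far_dim0.
pose a : R := n%:R `^ (1 / 6); pose k := up_log 2 (2 * n).
have hk : (2 * n <= 2 ^ k)%N by exact: up_logP.
have n1 : 1 <= n%:R :> R by rewrite ler1n.
have a1 : 1 <= a.
  by rewrite -(powRr0 n%:R); apply: ler_powR => //; lra.
have aX m : a ^+ m = n%:R `^ (m%:R / 6).
  by rewrite -powR_mulrn ?powR_ge0 // -powRrM; congr powR; lra.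
have a6 : a ^+ 6 = n%:R by rewrite aX divff ?pnatr_eq0 // powRr1.
have a5 : n%:R `^ (5 / 6) = a ^+ 5 by rewrite aX.
have q01 := bias01 n0 hk a1 eps01.
pose s := matching_density eps a k.
pose d := s ^+ 2 / (96 * a ^+ 3).
have a0 : 0 < a by lra.
have /andP[e0 e1] := eps01.
have k0 : 0 < k%:R :> R.
  by rewrite ltr0n /k up_log_gt0 /=; case: (n) n0 => // m _; rewrite mulnS.
have s0 : 0 < s := matching_density_gt0 n0 hk a1 eps01.
have s1 : s * a <= 1 := matching_density_le n0 hk a1 eps01.
have d0 : 0 < d.
  apply: divr_gt0; first exact: exprn_gt0.
  by apply: mulr_gt0 => //; exact: exprn_gt0.
(* The successor ensures [N * d >= 2]; with [d <= 1], the [2 N] queries are at most [6 / d]. *)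
pose N := (Num.truncn (2 / d)).+1.
have /andP[N1 N2] := truncn_itv (ltW (divr_gt0 (ltr0Sn R 1) d0)).
exists (repeated_test (pair_low (n := n)) (pair_high (n := n)) N
   (pair_law_ge0 q01) (sum_pair_law (bias eps a k) n0)) => _; split.
- by move=> f; apply: repeated_always_yes => t i; exact: pair_le.
- move=> f far; apply: (@repeated_prob_no_ge _ _ _ _ _ _ _ _ _ d) => //; first exact: ltW.
    by move: (ltW N2); rewrite ler_pdivrMr.
  rewrite pair_rejects //; exact: pair_test_detects.
apply: (@le_trans _ _ (2 * N)%:R); first by rewrite ler_nat; exact: repeated_complexity.
have d1 : 1 <= 1 / d.
  rewrite ler_pdivlMr // mul1r /d ler_pdivrMr ?mulr_gt0 ?exprn_gt0 // mul1r.
  have : 1 <= a ^+ 3 by exact: exprn_ege1.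
  have : s <= 1 by apply: le_trans s1; rewrite ler_peMr // ltW.
  by nra.
apply: (@le_trans _ _ (6 / d)).
  have -> : (2 * N)%:R = 2 * ((Num.truncn (2 / d))%:R + 1) :> R by rewrite natrM natr1.
  by move: N1 d1; lra.
have -> : 6 / d = 576 * 512 ^+ 2 * (k%:R ^+ 4) * rate n eps.
  rewrite /rate a5 /d /s /matching_density; field.
  by rewrite !gt_eqF.
have hkl := up_log_rate n0 eps01.
have l0 := ln_rate_ge0 n e0.
have l2 : 0 < ln 2 :> R by rewrite ln_gt0 //; lra.
have -> : query_constant * rate n eps * ln (2 + rate n eps) ^+ 4 =
   576 * 512 ^+ 2 * (4 / ln 2 * ln (2 + rate n eps)) ^+ 4 * rate n eps.
  by rewrite /query_constant [in RHS]exprMn; ring.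
apply: ler_wpM2r; first exact: rate_ge0.
apply: ler_wpM2l; first by apply: mulr_ge0 => //; exact: exprn_ge0.
apply: lerXn2r; rewrite ?nnegrE //.
by apply: mulr_ge0 => //; apply: divr_ge0 => //; exact: ltW.
Qed.

End Algorithm.

Theorem theorem1p3 (R : realType) :
  exists A : forall n : nat, R -> nonadaptive_algorithm R n,
    [/\ forall (n : nat) (eps : R) (f : cube n -> bool),
          0 < eps -> monotone f -> always_yes (A n eps) f,
        forall (n : nat) (eps : R) (f : cube n -> bool),
          0 < eps -> far_from_monotone eps f ->
          2%:R / 3%:R <= prob_no (A n eps) f
      & soft_bigO (fun p : nat * R => 0 < p.2)
          (fun p => (query_complexity (A p.1 p.2))%:R)
          (fun p => p.1%:R `^ (5%:R / 6%:R) * p.2 ^- 4)].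
Proof.
exists (fun n eps => sval (tester n eps)); split.
- by move=> n eps f e0; case: (svalP (tester n eps) e0) => + _ _; apply.
- by move=> n eps f e0; case: (svalP (tester n eps) e0) => _ + _; apply.
exists (query_constant R), 4%N => -[n eps] /= e0.
by case: (svalP (tester n eps) e0).
Qed.
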